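(* Let $m\geq 2$, and let $(G_n)_{n\ge0}$ be defined inductively by $G_0=\mathbb Z$ and $G_{n+1}=\mathbb Z/m\mathbb Z\wr G_n$. For every integer $n\geq 1$, there exists an orbit equivalence coupling from $\mathbb Z$ to $G_n$ which is $(\mathrm L^{<\infty},\varphi_{n,\varepsilon})$-integrable for every $\varepsilon>0$, where $\varphi_{n,\varepsilon}=\log^{\circ n}/(\log^{\circ(n+1)})^{1+\varepsilon}$.
   Context: $\log^{\circ n}$ denotes $\log$ composed with itself $n$ times. Wreath product: $F\wr H=\left(\bigoplus_{H}F\right)\rtimes H$, with $H$ acting by shifting the coordinates. An orbit equivalence coupling from $\Gamma=\langle S_\Gamma\rangle$ to $\Lambda=\langle S_\Lambda\rangle$ ($S_\Gamma,S_\Lambda$ finite symmetric) is a standard probability space $(X,\mu)$ with free (up to null sets) measure-preserving actions of $\Gamma$ and $\Lambda$ such that $\Gamma\cdot x=\Lambda\cdot x$ for almost every $x\in X$. For $y\in\Lambda\cdot x$, $d_{S_\Lambda}(x,y)$ is the minimal word length of $\lambda\in\Lambda$ with $y=\lambda\cdot x$; $d_{S_\Gamma}$ is defined similarly. For a non-decreasing function $\psi\colon[0,\infty)\to[0,\infty)$, the coupling is $(\mathrm L^{<\infty},\psi)$-integrable if for all $\gamma\in\Gamma$ and all $1\le p<\infty$, $\int_Xd_{S_\Lambda}(x,\gamma\cdot x)^p\,d\mu(x)<\infty$, and for all $\lambda\in\Lambda$ there is $c_\lambda>0$ with $\int_X\psi\left(d_{S_\Gamma}(x,\lambda\cdot x)/c_\lambda\right)d\mu(x)<\infty$.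 Integrability depends only on the behaviour of $\psi$ at infinity; the formula for $\varphi_{n,\varepsilon}$ is meant for large arguments, and $\varphi_{n,\varepsilon}$ denotes any non-decreasing function $[0,\infty)\to[0,\infty)$ coinciding with it for large arguments. *)

(* Defs.v *)
From HB Require Import structures.
From mathcomp Require Import all_boot all_order all_algebra finmap.
From mathcomp Require Import all_classical all_reals all_analysis.
Set Implicit Arguments.
Unset Strict Implicit.
Unset Printing Implicit Defensive.
Import Order.TTheory GRing.Theory Num.Theory Algebra.
Import numFieldNormedType.Exports.

Local Open Scope classical_set_scope.
Local Open Scope fset_scope.
Local Open Scope ring_scope.

(* The restricted wreath product: finitely supported lamp configurations
   H -> F together with a cursor in H. As H acts on configurations by left
   translation, (f, h) * (f', h') = (x |-> f x * f' (h^-1 * x), h * h'). *)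
Record wreath (F H : groupType) :=
  Wreath { lamps : {fsfun H -> F with 1%g}; cursor : H }.

Section WreathGroup.
Local Open Scope group_scope.
Variables F H : groupType.
Implicit Types u v w : wreath F H.

Definition wreath_pair u := (lamps u, cursor u).
Definition pair_wreath p : wreath F H := Wreath p.1 p.2.
Fact wreath_pairK : cancel wreath_pair pair_wreath. Proof. by case. Qed.
HB.instance Definition _ := Choice.copy (wreath F H) (can_type wreath_pairK).

Definition wreath_one : wreath F H := Wreath [fsfun] 1.

Definition wreath_mul u v : wreath F H :=
  Wreath [fsfun x in (finsupp (lamps u) `|`
                      [fset cursor u * y | y in finsupp (lamps v)])%fset
            => lamps u x * lamps v ((cursor u)^-1 * x)]
         (cursor u * cursor v).

Definition wreath_inv u : wreath F H :=
  Wreath [fsfun x in [fset (cursor u)^-1 * y | y in finsupp (lamps u)]%fset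
            => (lamps u (cursor u * x))^-1]
         (cursor u)^-1.

Lemma lamps1 x : lamps wreath_one x = 1.
Proof. by rewrite /= fsfunE. Qed.

Lemma lampsM u v x :
  lamps (wreath_mul u v) x = lamps u x * lamps v ((cursor u)^-1 * x).
Proof.
rewrite /= fsfunE; case: ifPn => //; rewrite in_fsetU negb_or memNfinsupp.
move=> /andP[/eqP -> nv]; rewrite mul1g; apply/esym/eqP.
rewrite -memNfinsupp; apply: contra nv => xv.
by apply/imfsetP; exists ((cursor u)^-1 * x) => //=; rewrite mulVKg.
Qed.

Lemma lampsV u x : lamps (wreath_inv u) x = (lamps u (cursor u * x))^-1.
Proof.
rewrite /= fsfunE; case: ifPn => // nu; apply/esym/eqP.
rewrite invg_eq1 -memNfinsupp; apply: contra nu => xu.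
by apply/imfsetP; exists (cursor u * x) => //=; rewrite mulKg.
Qed.

Lemma wreathP u v : lamps u =1 lamps v -> cursor u = cursor v -> u = v.
Proof. by case: u v => [f h] [f' h'] /= /fsfunP -> ->. Qed.

Fact wreath_mulA : associative wreath_mul.
Proof.
move=> u v w; apply: wreathP => [x|]; last by rewrite /= mulgA.
by rewrite !lampsM /= invgM !mulgA.
Qed.

Fact wreath_mul1g : left_id wreath_one wreath_mul.
Proof.
move=> u; apply: wreathP => [x|]; last by rewrite /= mul1g.
by rewrite lampsM lamps1 /= invg1 !mul1g.
Qed.

Fact wreath_mulg1 : right_id wreath_one wreath_mul.
Proof.
move=> u; apply: wreathP => [x|]; last by rewrite /= mulg1.
by rewrite lampsM lamps1 mulg1.
Qed.

Fact wreath_mulVg : left_inverse wreath_one wreath_inv wreath_mul.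
Proof.
move=> u; apply: wreathP => [x|]; last by rewrite /= mulVg.
by rewrite lampsM lampsV lamps1 /= invgK mulVg.
Qed.

Fact wreath_mulgV : right_inverse wreath_one wreath_inv wreath_mul.
Proof.
move=> u; apply: wreathP => [x|]; last by rewrite /= mulgV.
by rewrite lampsM lampsV lamps1 mulVKg mulgV.
Qed.

HB.instance Definition _ := isGroup.Build (wreath F H)
  wreath_mulA wreath_mul1g wreath_mulg1 wreath_mulVg wreath_mulgV.

End WreathGroup.

Definition Zgroup : groupType := to_multiplicative int.

(* 'Z_m has m elements only for 1 < m. *)
Definition Zmod_group (m : nat) : groupType := to_multiplicative 'Z_m.

Fixpoint iterated_wreath (m n : nat) : groupType :=
  if n is k.+1 then wreath (Zmod_group m) (iterated_wreath m k) else Zgroup.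

Section WordLength.
Variable G : groupType.
Implicit Types (S : set G) (g : G).

Definition words S g : set (seq G) :=
  [set w | (forall s, s \in w -> S s) /\ (\prod_(s <- w) s)%g = g].

Definition finite_symmetric_generating S : Prop :=
  [/\ finite_set S, (forall s, S s -> S s^-1%g) & forall g, words S g !=set0].

(* The minimum of a set of natural numbers; 0 for the empty set. *)
Definition min_nat (A : set nat) : nat :=
  xget 0%N [set k | A k /\ forall j, A j -> (k <= j)%N].

Definition word_length S g : nat := min_nat [set size w | w in words S g].

End WordLength.

Section FiniteGeneration.
Local Open Scope group_scope.

Definition generates (G : groupType) (s : seq G) :=
  forall K : set G, K 1 -> (forall x y, K x -> K y -> K (x * y)) ->
    (forall x, x \in s -> K x) -> forall g, K g.

Lemma generates_words (G : groupType) (s : seq G) : generates s ->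
  exists S : set G, finite_symmetric_generating S.
Proof.
move=> gens; exists [set` s ++ [seq x^-1 | x <- s]]; split.
- exact: finite_seq.
- move=> x /=; rewrite !mem_cat => /orP[xs|/mapP[y ys ->]].
    by rewrite orbC map_f.
  by rewrite invgK ys.
apply: gens => [|x y [u [us <-]] [v [vs <-]]|x xs].
- by exists [::]; split => //; rewrite big_nil.
- exists (u ++ v); split; last by rewrite big_cat.
  by move=> z; rewrite mem_cat => /orP[/us|/vs].
- exists [:: x]; split; last by rewrite big_seq1.
  by move=> z; rewrite inE => /eqP -> /=; rewrite mem_cat xs.
Qed.

Lemma generates_Zgroup : generates ([:: (1%R : int); (-1)%R] : seq Zgroup).
Proof.
move=> K K1 KM Ks.
have Kp (k : nat) : K (k%:Z : Zgroup).
  elim: k => // k IH; rewrite -addn1 PoszD.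
  by apply: (KM (k%:Z : Zgroup) (1%R : int) IH); apply: Ks; rewrite !inE eqxx.
have Kn (k : nat) : K ((- k%:Z)%R : Zgroup).
  elim: k => [|k IH]; first by rewrite oppr0.
  rewrite -addn1 PoszD opprD.
  apply: (KM ((- k%:Z)%R : Zgroup) ((-1)%R : int) IH).
  by apply: Ks; rewrite !inE eqxx orbT.
by case=> k; [exact: Kp | rewrite NegzE; exact: Kn].
Qed.

Lemma generates_Zmod_group m :
  generates (enum 'Z_m : seq (Zmod_group m)).
Proof. by move=> K _ _ Ks g; apply: Ks; rewrite mem_enum. Qed.

Section GeneratesWreath.
Variables F H : groupType.

Definition lamp_at (x : H) (a : F) : wreath F H :=
  Wreath [fsfun [fsfun] with x |-> a] 1.
Definition cursor_at (h : H) : wreath F H := Wreath [fsfun] h.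

Lemma lamp_atE x a y : lamps (lamp_at x a) y = if y == x then a else 1.
Proof. by rewrite /= fsfun_withE fsfunE. Qed.

Lemma lamp_atM x a b : lamp_at x (a * b) = lamp_at x a * lamp_at x b.
Proof.
apply: wreathP => [y|]; last by rewrite /= mulg1.
by rewrite lampsM !lamp_atE /= invg1 mul1g; case: eqP; rewrite ?mulg1.
Qed.

Lemma cursor_atM h k : cursor_at (h * k) = cursor_at h * cursor_at k.
Proof. by apply: wreathP => [y|//]; rewrite lampsM /= !fsfunE mulg1. Qed.

Lemma lamp_at_conj x a :
  lamp_at x a = cursor_at x * lamp_at 1 a * cursor_at x^-1.
Proof.
apply: wreathP => [y|]; last by rewrite /= mulg1 mulgV.
rewrite lamp_atE !lampsM lamp_atE /= !fsfunE mul1g mulg1.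
by rewrite -[in RHS](mulVg x) (inj_eq (mulgI x^-1)).
Qed.

Lemma generates_wreath (sF : seq F) (sH : seq H) :
  generates sF -> generates sH ->
  generates (map (lamp_at 1) sF ++ map cursor_at sH).
Proof.
move=> genF genH K K1 KM Ks.
have KH h : K (cursor_at h).
  move: h; apply: genH => [|x y Kx Ky|x xs].
  - exact: K1.
  - by rewrite cursor_atM; apply: KM.
  - by apply: Ks; rewrite mem_cat map_f ?orbT.
have KF x a : K (lamp_at x a).
  rewrite lamp_at_conj; apply: (KM _ _ _ (KH _)); apply: (KM _ _ (KH _)).
  move: a; apply: genF => [|a b Ka Kb|a as_].
  - suff -> : lamp_at 1 1 = 1 by [].
    by apply: wreathP => // y; rewrite lamp_atE lamps1 if_same.
  - by rewrite lamp_atM; apply: KM.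
  - by apply: Ks; rewrite mem_cat map_f.
move=> [f h].
have -> : Wreath f h = Wreath f 1 * cursor_at h.
  apply: wreathP => [y|]; last by rewrite /= mul1g.
  by rewrite lampsM /= fsfunE mulg1.
apply: (KM _ _ _ (KH h)); have [k] := ubnP #|` finsupp f|.
elim: k f => // k IH f; rewrite ltnS => fk.
have [f0|[x xf]] := fset_0Vmem (finsupp f).
  suff -> : Wreath f 1 = 1 :> wreath F H by [].
  apply: wreathP => // y; rewrite lamps1 /=; apply/eqP.
  by rewrite -memNfinsupp f0 in_fset0.
have -> : Wreath f 1 = lamp_at x (f x) * Wreath [fsfun f with x |-> 1] 1.
  apply: wreathP => [y|]; last by rewrite /= mulg1.
  rewrite lampsM lamp_atE /= invg1 mul1g fsfun_withE.
  by case: eqP => [->|_]; rewrite ?mulg1 ?mul1g.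
apply: (KM _ _ (KF x (f x))); apply: IH; rewrite finsupp_with eqxx.
by rewrite (leq_trans _ fk) // [X in (_ < X)%N](cardfsD1 x) xf.
Qed.

End GeneratesWreath.

Lemma iterated_wreath_fg m n :
  exists S : set (iterated_wreath m n), finite_symmetric_generating S.
Proof.
suff [s gens] : exists s : seq (iterated_wreath m n), generates s.
  exact: generates_words gens.
elim: n => [|n [s gens]]; first by eexists; exact: generates_Zgroup.
by eexists; apply: generates_wreath gens; exact: generates_Zmod_group.
Qed.

End FiniteGeneration.

(* The coordinate x |-> act g x of a left action is written act g : X -> X. *)
Section Couplings.
Context (R : realType) (d : measure_display) (X : measurableType d).

Definition standard_borel : Prop :=
  exists (P : completePseudoMetricType R) (f : X -> P),
    [/\ hausdorff_space P,
        exists2 D : set P, countable D & dense D,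
        bijective f &
        (@measurable d X : set (set X)) =
          preimage_set_system setT f <<s @open P >>].

Variable mu : probability X R.

Record pmp_free_action (G : groupType) (act : G -> X -> X) : Prop := {
  pmp_act1 : forall x, act 1%g x = x;
  pmp_actM : forall g h x, act (g * h)%g x = act g (act h x);
  pmp_measurable : forall g, measurable_fun setT (act g);
  pmp_preserving : forall g (A : set X), measurable A ->
    mu (act g @^-1` A) = mu A;
  pmp_free : {ae mu, forall x, forall g, act g x = x -> g = 1%g}
}.

Definition orbit (G : groupType) (act : G -> X -> X) (x : X) : set X :=
  [set act g x | g in setT].

Record oe_coupling (Gamma Lambda : groupType)
    (a : Gamma -> X -> X) (b : Lambda -> X -> X) : Prop := {
  oe_standard : standard_borel;
  oe_left : pmp_free_action a;
  oe_right : pmp_free_action b;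
  oe_orbits : {ae mu, forall x, orbit a x = orbit b x}
}.

(* Meaningful for y in the orbit of x; 0 otherwise, which under an orbit
   equivalence coupling only concerns a null set of x. *)
Definition orbit_dist (G : groupType) (S : set G) (act : G -> X -> X)
    (x y : X) : nat :=
  min_nat [set word_length S g | g in [set g | y = act g x]].

Definition Linfty_psi_integrable (Gamma Lambda : groupType)
    (SG : set Gamma) (SL : set Lambda)
    (a : Gamma -> X -> X) (b : Lambda -> X -> X) (psi : R -> R) : Prop :=
  (forall (g : Gamma) (p : R), 1 <= p ->
     (\int[mu]_x (((orbit_dist SL b x (a g x))%:R `^ p)%:E) < +oo)%E) /\
  (forall l : Lambda, exists2 c : R, 0 < c &
     (\int[mu]_x ((psi ((orbit_dist SG a x (b l x))%:R / c))%:E) < +oo)%E).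

End Couplings.

Definition phi_formula (R : realType) (n : nat) (eps x : R) : R :=
  iter n (@ln R) x / (iter n.+1 (@ln R) x) `^ (1 + eps).

(* psi represents a function [0, oo[ -> [0, oo[; its values on negative
   arguments are irrelevant. *)
Definition represents_phi (R : realType) (n : nat) (eps : R) (psi : R -> R) :
    Prop :=
  [/\ forall x y, 0 <= x -> x <= y -> psi x <= psi y,
      forall x, 0 <= x -> 0 <= psi x &
      \forall x \near +oo, psi x = phi_formula n eps x].

(* Main.v *)
(* Tile G_n by finite sets F_k with F_{k+1} a disjoint union of right
   translates of F_k, and cut [0, 1[ into |F_k| intervals of equal length
   indexed by F_k, so that the intervals of level k+1 refine those of level k.
   An element g of G_n translates the interval indexed by u onto the one indexed
   by g u whenever g u is in F_k; this does not depend on k and defines almost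
   everywhere a free measure-preserving action, whose orbits depend on the
   numbers |F_k| only.  Tiling Z by intervals of length |F_k| gives an orbit
   equivalent action.
   For the integrability, let a_k = |F_k|.  A point at which g leaves its level-k
   interval but not its level-(k+1) interval is moved, for the metric of the other
   group, by at most the diameter of the level-(k+1) tile of that group; such
   points form a set of measure O(1/a_k) for g in Z and O(2^-k) for g in G_n.
   For n = 0 take F_k = [0, 2^k[; for the wreath product take the pairs (f, h)
   with h in F_k and f supported in h F_k^-1, so that a_k becomes a_k m^(a_k) and
   the diameter d_k becomes O(a_k d_k).  Thus log^n a_k = O(2^k), and everything
   reduces to the convergence of sum_k d_{k+1}^p / a_k and of
   sum_k 1 / k^(1 + eps). *)

Require Import Defs.
From HB Require Import structures.
From mathcomp Require Import all_boot all_order all_algebra finmap.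
From mathcomp Require Import all_classical all_reals all_analysis.
From mathcomp Require Import measurable_realfun zify lra.
Set Implicit Arguments.
Unset Strict Implicit.
Unset Printing Implicit Defensive.
Import Order.TTheory GRing.Theory Num.Theory.
Import numFieldNormedType.Exports.
Local Open Scope fset_scope.

(** * Tilings of groups *)

Section Tilings.
Local Open Scope group_scope.
Variable H : groupType.
Implicit Types (A B S : {fset H}) (F : nat -> {fset H}).

(* Every element of B is uniquely u * s with u in A and s in S: the map
   u * s |-> u is well defined, which forces s as well. *)
Definition tiles A B S :=
  (forall u v s s', u \in A -> v \in A -> s \in S -> s' \in S ->
     u * s = v * s' -> u = v) /\
  (forall w, w \in B <-> exists u s, [/\ u \in A, s \in S & w = u * s]).

Definition tile_sequence F :=
  (forall k, 1 \in F k) /\ (forall k, exists S, tiles (F k) (F k.+1) S).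

Definition escaping A (h : H) : {fset H} := [fset u in A | h * u \notin A].

(** A quantitative Folner condition with rate 1 / [r k]; the constant may depend on [h]. *)
Definition escape_rate F (r : nat -> nat) :=
  forall h, exists C, forall k, (r k * #|` escaping (F k) h| <= C * #|` F k|)%N.

Definition subadditive_length (L : H -> nat) :=
  forall x y, (L (x * y)%g <= L x + L y)%N.

(** Every subadditive [L] is allowed, rather than one word length, so that the wreath product step
    can apply the bound to [L] restricted to cursors, with or without inversion. *)
Definition length_growth F (l : nat -> nat) :=
  forall L, subadditive_length L ->
  exists C, forall k u, u \in F k -> (L u <= C * l k)%N.

(* The digits of [i] are read from the most significant one, so that a level-k
   tile is an interval of indices at every finer level: the index i at level k
   splits into the indices i * q, ..., i * q + q.-1 at level k.+1. *)
Record tile_enum (a : nat -> nat) F (t : nat -> nat -> H) : Prop := {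
  tile_enum_inj : forall k i j, (i < a k)%N -> (j < a k)%N ->
    t k i = t k j -> i = j;
  tile_enum_mem : forall k i, (i < a k)%N -> t k i \in F k;
  tile_enum_surj : forall k u, u \in F k -> exists2 i, (i < a k)%N & t k i = u;
  tile_enum_step : forall k, exists q s, [/\ (0 < q)%N, a k.+1 = (a k * q)%N &
    forall i, t k.+1 i = t k (i %/ q) * s (i %% q)]
}.

(** [t] is a mixed-radix enumeration: the quotient of an index picks an element of the coarser tile,
    the remainder picks the translate. Uniqueness in [tiles] makes it injective. *)
Lemma tile_sequence_enum F : tile_sequence F ->
  exists t, tile_enum (fun k => #|` F k|) F t.
Proof.
move=> [F1 /choice[S tS]].
pose t := fix t k i := if k is k'.+1 then
  t k' (i %/ #|` S k'|) * nth 1 (S k') (i %% #|` S k'|) else nth 1 (F 0%N) i.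
have q_gt0 k : (0 < #|` S k|)%N.
  have /(tS k).2[u [s [_ sS _]]] := F1 k.+1.
  by rewrite cardfs_gt0; apply/fset0Pn; exists s.
have E k : [/\ uniq (mkseq (t k) #|` F k|), mkseq (t k) #|` F k| =i F k &
    #|` F k.+1| = (#|` F k| * #|` S k|)%N].
  have next k' : uniq (mkseq (t k') #|` F k'|) ->
      mkseq (t k') #|` F k'| =i F k' ->
      let s := mkseq (t k'.+1) (#|` F k'| * #|` S k'|)%N in
      uniq s /\ s =i F k'.+1.
    move=> Uk Ek s.
    have tF i : (i < #|` F k'|)%N -> t k' i \in F k'.
      by move=> iF; rewrite -Ek; apply/mapP; exists i => //; rewrite mem_iota.
    have sS i : nth 1 (S k') (i %% #|` S k'|) \in S k'.
      by apply: mem_nth; rewrite ltn_mod.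
    split.
      apply/mkseq_uniqP => i j; rewrite !inE => iF jF /= eq_ij.
      have di : (i %/ #|` S k'| < #|` F k'|)%N by rewrite ltn_divLR.
      have dj : (j %/ #|` S k'| < #|` F k'|)%N by rewrite ltn_divLR.
      have eu := (tS k').1 _ _ _ _ (tF _ di) (tF _ dj) (sS i) (sS j) eq_ij.
      move: eq_ij; rewrite eu => /mulgI es.
      have em : i %% #|` S k'| = j %% #|` S k'|.
        apply/eqP.
        by rewrite -(nth_uniq 1 _ _ (fset_uniq (S k'))) ?ltn_mod// es.
      have ed : i %/ #|` S k'| = j %/ #|` S k'|.
        by apply: (mkseq_uniqP _ _ Uk) => //.
      by rewrite (divn_eq i #|` S k'|) (divn_eq j #|` S k'|) em ed.
    move=> w; apply/mapP/idP => [[i]|/(tS k').2[u [v [uF vS ->]]]].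
      rewrite mem_iota /= add0n => iF ->; apply/(tS k').2.
      exists (t k' (i %/ #|` S k'|)), (nth 1 (S k') (i %% #|` S k'|)).
      by split => //; apply: tF; rewrite ltn_divLR.
    move: uF; rewrite -Ek => /mapP[i]; rewrite mem_iota /= add0n => iF ->.
    have vq : (index v (S k') < #|` S k'|)%N by rewrite index_mem.
    exists (i * #|` S k'| + index v (S k'))%N.
      rewrite mem_iota /= add0n; apply: (@leq_trans (i.+1 * #|` S k'|)%N).
        by rewrite mulSn addnC ltn_add2r.
      by rewrite leq_mul2r iF orbT.
    by rewrite divnMDl// divn_small// addn0 modnMDl modn_small// nth_index.
  have card k' : uniq (mkseq (t k') #|` F k'|) ->
      mkseq (t k') #|` F k'| =i F k' ->
      #|` F k'.+1| = (#|` F k'| * #|` S k'|)%N.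
    move=> Uk Ek; have [Us Es] := next _ Uk Ek.
    rewrite -[RHS](size_mkseq (t k'.+1)).
    by apply/eqP; rewrite -(uniq_size_uniq Us Es) fset_uniq.
  suff [Uk Ek] : uniq (mkseq (t k) #|` F k|) /\ mkseq (t k) #|` F k| =i F k.
    by split => //; exact: card.
  elim: k => [|k [Uk Ek]]; last by rewrite card//; exact: next.
  by rewrite /= mkseq_nth; split; first exact: fset_uniq.
exists t; split.
- by move=> k i j ik jk; case: (E k) => /(mkseq_uniqP _ _) + _ _; exact.
- move=> k i ik; case: (E k) => _ <- _.
  by apply/mapP; exists i => //; rewrite mem_iota.
- move=> k u; case: (E k) => _ <- _ /mapP[i].
  by rewrite mem_iota /= add0n => ik ->; exists i.
- by move=> k; exists #|` S k|, (nth 1 (S k)); split => //; case: (E k).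
Qed.

End Tilings.

Lemma card_imfset_iota (T : choiceType) (f : nat -> T) (i n : nat) :
  (#|` [fset f j | j in iota i n]| <= n)%N.
Proof.
rewrite (leq_trans (leq_imfset_card _ _ _))//=.
by rewrite -[leqRHS](size_iota i) size_undup.
Qed.

(** * Interval tiles of the integers *)

Section ZIntervals.
Local Open Scope ring_scope.

Definition Zinterval (n : nat) : {fset Zgroup} :=
  [fset (i%:Z : Zgroup) | i in iota 0 n].

Lemma in_Zinterval (n : nat) (u : int) :
  (u \in Zinterval n) = (0 <= u < n%:Z).
Proof.
apply/imfsetP/idP => [[i /=]|/andP[]].
  by rewrite mem_iota add0n => iN ->; lia.
by case: u => // i _ iN; exists i => //=; rewrite mem_iota.
Qed.

Lemma card_Zinterval (n : nat) : #|` Zinterval n| = n.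
Proof.
rewrite card_imfset /=; last by move=> i j [].
by rewrite undup_id ?size_iota ?iota_uniq.
Qed.

Variable a : nat -> nat.
Hypothesis a_gt0 : forall k, (0 < a k)%N.

Lemma tile_sequence_Zinterval : (forall k, a k %| a k.+1)%N ->
  tile_sequence (fun k => Zinterval (a k)).
Proof.
move=> a_dvd; split => k; first by rewrite in_Zinterval ltz_nat a_gt0.
have /dvdnP[q aq] := a_dvd k.
(* Euclidean division by [a k] gives the decomposition, reduction modulo [a k] its uniqueness. *)
exists [fset ((d * a k)%N%:Z : Zgroup) | d in iota 0 q]; split.
  move=> u v s s'; rewrite !in_Zinterval => u_a v_a.
  move=> /imfsetP[d _ ->] /imfsetP[d' _ ->] /= e.
  have {}e : (u : int) + (d * a k)%N%:Z = (v : int) + (d' * a k)%N%:Z by [].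
  have /eqP := congr1 (fun z : int => (z %% (a k)%:Z)%Z) e.
  by rewrite !PoszM ![_ + _ * _]addrC !modzMDl !modz_small// => /eqP.
move=> w; rewrite in_Zinterval; split => [|[u [s [+ /imfsetP[d /= + ->] ->]]]].
  case: w => // w; rewrite /= ltz_nat aq => wa.
  exists ((w %% a k)%N%:Z : Zgroup), ((w %/ a k * a k)%N%:Z : Zgroup); split.
  - by rewrite in_Zinterval /= ltz_nat ltn_mod a_gt0.
  - apply/imfsetP; exists (w %/ a k)%N => //=.
    by rewrite mem_iota /= ltn_divLR.
  - rewrite -[RHS]/((w %% a k)%N%:Z + (w %/ a k * a k)%N%:Z).
    by rewrite -PoszD addnC -divn_eq.
rewrite in_Zinterval mem_iota add0n => /andP[u0 ua] dq.
rewrite -[X in _ <= X < _]/(u + (d * a k)%N%:Z) addr_ge0//= aq.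
have : (d.+1 * a k <= q * a k)%N by rewrite leq_mul2r (andP dq).2 orbT.
by rewrite mulSn; lia.
Qed.

Lemma escape_rate_Zinterval : escape_rate (fun k => Zinterval (a k)) a.
Proof.
move=> h; exists (absz h) => k; rewrite card_Zinterval mulnC leq_mul2r.
apply/orP; right.
(* Only the first |h| points escape if h <= 0, and only the last |h| if h > 0; [f] counts from that
   end. *)
pose f (i : nat) : Zgroup :=
  if (h : int) <= 0 then i%:Z else (a k)%:Z - 1 - i%:Z.
apply: (@leq_trans #|` [fset f i | i in iota 0 (absz h)]|); last first.
  exact: card_imfset_iota.
apply/fsubset_leq_card/fsubsetP => u; rewrite !inE !in_Zinterval => /andP[].
rewrite -[X in _ <= X < _ -> _]/(u : int) => /andP[u0 ua].
rewrite -[X in _ <= X < _]/((h : int) + (u : int)) => hu.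
apply/imfsetP; have [h0|/negbTE h0] := boolP ((h : int) <= 0).
  exists (absz u); first by rewrite /= mem_iota add0n; lia.
  have e : (u : int) = (absz u)%:Z by lia.
  by rewrite /f h0; exact: e.
exists (absz ((a k)%:Z - 1 - u)%R); first by rewrite /= mem_iota add0n; lia.
have e : (u : int) = (a k)%:Z - 1 - (absz ((a k)%:Z - 1 - u)%R)%:Z by lia.
by rewrite /f h0; exact: e.
Qed.

Lemma length_growth_Zinterval : length_growth (fun k => Zinterval (a k)) a.
Proof.
move=> L subL.
have bound (s : Zgroup) (i : nat) : (L ((s : int) *+ i) <= L 0%R + i * L s)%N.
  elim: i => [|i IH]; first by rewrite mulr0n mul0n addn0.
  rewrite mulrS; apply: leq_trans (subL s ((s : int) *+ i)) _.
  by rewrite mulSn addnCA leq_add2l.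
exists (L 0%R + L (1 : int))%N => k u.
rewrite in_Zinterval; case: u => // i /= ia.
have := bound (1 : int) i; rewrite -[1 *+ i]/(i%:R : int) natz.
have := a_gt0 k; move: ia; rewrite ltz_nat.
set y := L (Posz i); set z := L 0; set v := L _.
by nia.
Qed.

End ZIntervals.

(** * Tiles of a wreath product *)

Section WreathTiles.
Local Open Scope group_scope.
Variables (m : nat) (m_gt1 : (1 < m)%N) (H : groupType).
Implicit Types (A B : {fset H}) (F : nat -> {fset H}).
Notation W := (wreath (Zmod_group m) H).

Lemma wreath_lampsM (v w : W) x :
  lamps (v * w) x = lamps v x * lamps w ((cursor v)^-1 * x).
Proof. exact: lampsM. Qed.

Lemma wreath_lampsV (v : W) x : lamps v^-1 x = (lamps v (cursor v * x))^-1.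
Proof. exact: lampsV. Qed.

(** A lamp at x is recorded under x^-1 h, where h is the cursor. This coordinate is unchanged when a
    left multiplication moves lamps and cursor together, and it identifies the configurations
    supported in h A^-1 with functions on [A], for every h. *)
Definition lamp_config A (p : A * {ffun A -> 'Z_m}) : W :=
  Wreath [fsfun x in [fset \val p.1 * u^-1 | u in A] =>
            (if insub (x^-1 * \val p.1) is Some u then p.2 u else 0%R)
              : Zmod_group m]
         (\val p.1).

Definition wreath_tile A : {fset W} :=
  [fset lamp_config p | p in {: A * {ffun A -> 'Z_m}}].

Lemma lamp_configE A (p : A * {ffun A -> 'Z_m}) u :
  lamps (lamp_config p) (\val p.1 * (\val u)^-1) = p.2 u.
Proof.
rewrite fsfunE ifT; last by apply/imfsetP; exists (\val u); first exact: valP.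
by rewrite invgM invgK mulgVK valK.
Qed.

Lemma lamp_config_inj A : injective (@lamp_config A).
Proof.
move=> [h w] [h' w'] e; have eh : h = h'.
  by apply: val_inj; have := congr1 (fun v : W => cursor v) e.
rewrite -eh in e *; congr pair; apply/ffunP => u.
by rewrite -(lamp_configE (h, w)) e lamp_configE.
Qed.

Lemma card_wreath_tile A : #|` wreath_tile A| = (#|` A| * m ^ #|` A|)%N.
Proof.
rewrite card_imfset /=; last exact: lamp_config_inj.
by rewrite -cardE card_prod card_ffun !card_ord cardfE Zp_cast.
Qed.

Lemma in_wreath_tile A (v : W) : reflect
  (cursor v \in A /\ forall x, lamps v x <> 1 -> x^-1 * cursor v \in A)
  (v \in wreath_tile A).
Proof.
apply: (iffP (imfsetP _ _ _ _)) => [[p _ ->]|[vA vx]].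
  split; first exact: valP.
  move=> x; rewrite fsfunE; case: ifP => // /imfsetP[u uA ->] _.
  by rewrite invgM invgK mulgVK.
pose h : A := [` vA].
exists (h, [ffun u => lamps v (\val h * (\val u)^-1) : 'Z_m]) => //.
apply: wreathP => //= x; rewrite fsfunE; case: ifP => [/imfsetP[u uA ->]|].
  by rewrite invgM invgK mulgVK -[u]/(\val [` uA]) valK ffunE.
have [-> //|/eqP /vx xA] := eqVneq (lamps v x) 1.
move=> /imfsetP[]; exists (x^-1 * cursor v) => //.
by rewrite invgM invgK mulVKg.
Qed.

(** The translating elements have cursor in [S] and all lamps off on A^-1. In a product with such an
    element, the lamps on h A^-1, for h the cursor of the first factor, are those of the first
    factor, which is thereby determined. *)
Lemma wreath_tile_tiles A B S : 1 \in A -> tiles A B S ->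
  exists S', tiles (wreath_tile A) (wreath_tile B) S'.
Proof.
move=> A1 [uniqS memB].
pose off (v : W) := all (fun u => lamps v u^-1 == 1) (enum_fset A).
have offP v u : off v -> u^-1 \in A -> lamps v u = 1.
  by move=> /allP/(_ _)/[apply]/eqP; rewrite invgK.
exists [fset v in wreath_tile B | (cursor v \in S) && off v]; split.
  move=> v v' s s' /in_wreath_tile[vA vx] /in_wreath_tile[v'A v'x].
  rewrite !inE => /and3P[_ sS offs] /and3P[_ s'S offs'] e.
  have eh : cursor v = cursor v'.
    by apply: uniqS vA v'A sS s'S _; have := congr1 (fun v : W => cursor v) e.
  apply: wreathP => // x; have [xA|xA] := boolP (x^-1 * cursor v \in A).
    have := congr1 (fun w => lamps w x) e; rewrite /= !wreath_lampsM.
    have xA' : ((cursor v)^-1 * x)^-1 \in A by rewrite invgM invgK.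
    by rewrite (offP _ _ offs)// -eh (offP _ _ offs')// !mulg1.
  have [->|/eqP/vx] := eqVneq (lamps v x) 1; last by rewrite (negPf xA).
  have [->//|/eqP/v'x] := eqVneq (lamps v' x) 1.
  by rewrite -eh (negPf xA).
move=> w; split => [/in_wreath_tile[wB wx]|[v [s [+ + ->]]]]; last first.
  move=> /in_wreath_tile[vA vx]; rewrite !inE.
  move=> /and3P[/in_wreath_tile[sB sx] sS offs]; apply/in_wreath_tile; split.
    by apply/memB; exists (cursor v), (cursor s).
  move=> x; rewrite wreath_lampsM.
  have [->|/eqP/vx xA _] := eqVneq (lamps v x) 1.
    by rewrite mul1g => /sx; rewrite invgM invgK mulgA.
  by rewrite mulgA; apply/memB; exists (x^-1 * cursor v), (cursor s).
have /memB[h [s [hA sS hs]]] := wB.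
(* Conversely, [v] keeps the lamps of [w] on h A^-1, and v^-1 w carries the others. *)
pose v : W := Wreath [fsfun x in [fset h * u^-1 | u in A] => lamps w x] h.
have vE x : lamps v x = if x^-1 * h \in A then lamps w x else 1.
  rewrite fsfunE; congr (if _ then _ else _).
  apply/imfsetP/idP => [[u uA ->]|xA]; first by rewrite invgM invgK mulgVK.
  by exists (x^-1 * h) => //; rewrite invgM invgK mulVKg.
have sE : cursor (v^-1 * w) = s by rewrite /= hs mulKg.
exists v, (v^-1 * w); split; last by rewrite mulVKg.
  apply/in_wreath_tile; split => // x.
  by rewrite vE; case: ifP.
have sB : s \in B by apply/memB; exists 1, s; rewrite mul1g.
rewrite !inE sE sS andTb; apply/andP; split.
  apply/in_wreath_tile; rewrite sE; split => // y.
  rewrite wreath_lampsM wreath_lampsV vE invgM /= invgK mulgVK.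
  case: ifP => _; rewrite ?mulVg// invg1 mul1g => /wx.
  by rewrite hs invgM -mulgA mulKg.
apply/allP => u uA.
by rewrite wreath_lampsM wreath_lampsV vE invgM /= !invgK mulgVK uA mulVg.
Qed.

Lemma tile_sequence_wreath F : tile_sequence F ->
  tile_sequence (fun k => wreath_tile (F k)).
Proof.
move=> [F1 tF]; split => k.
  by apply/in_wreath_tile; split => [|x]; [exact: F1 | rewrite lamps1].
by have [S] := tF k; exact: wreath_tile_tiles.
Qed.

Lemma card_has_escaping A (P : seq H) :
  (#|[pred u : A | has (fun h => h * \val u \notin A)%g P]| <=
   \sum_(h <- P) #|` escaping A h|)%N.
Proof.
elim: P => [|h P IH]; first by rewrite big_nil eq_card0.
rewrite big_cons; apply: leq_trans (leq_add (leqnn _) IH).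
have -> : escaping A h =
    [fset \val u | u in [pred u : A | h * \val u \notin A]].
  apply/fsetP => u; rewrite !inE; apply/andP/imfsetP => [[uA hu]|[v /= + ->]].
    by exists [` uA].
  by move=> hv; split => //; exact: valP.
rewrite card_imfset /=; last exact: val_inj.
by rewrite -cardE -cardUI -[leqLHS]addn0 leq_add//.
Qed.

(** Multiplication by [g] shifts the lamps of v with its cursor, so v can leave the tile only
    through its new cursor or through a lamp of [g]. These finitely many conditions, listed in [P],
    bear on the cursor of v alone, so the escaping proportion is at most a sum of escaping
    proportions in [F k]. *)
Lemma escape_rate_wreath F r : escape_rate F r ->
  escape_rate (fun k => wreath_tile (F k)) r.
Proof.
move=> /choice[C eC] g.
pose P := cursor g :: [seq x^-1 * cursor g | x <- finsupp (lamps g)].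
exists (\sum_(h <- P) C h)%N => k; set A := F k.
pose bad := [pred p : A * {ffun A -> 'Z_m} |
  has (fun h => h * \val p.1 \notin A) P].
have : (#|` escaping (wreath_tile A) g| <=
        #|` [fset lamp_config p | p in bad]|)%N.
  apply/fsubset_leq_card/fsubsetP => v; rewrite !inE => /andP[vA gvA].
  have /imfsetP[p _ vp] := vA; apply/imfsetP; exists p => //=.
  move: gvA; apply: contraNT => /hasPn badp; apply/in_wreath_tile.
  have hP h : h \in P -> h * cursor v \in A.
    by move=> /badp; rewrite negbK vp.
  split; first by apply: hP; rewrite inE eqxx.
  move=> x; rewrite wreath_lampsM; have [gx|gx] := eqVneq (lamps g x) 1.
    have [_ vx] := in_wreath_tile _ _ vA.
    by rewrite gx mul1g => /vx; rewrite invgM invgK mulgA.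
  move=> _; rewrite mulgA; apply: hP; rewrite inE; apply/orP; right.
  by apply/mapP; exists x => //; rewrite mem_finsupp.
move=> /leq_trans/(_ (leq_imfset_card _ _ _)) /=.
rewrite -cardE => le_bad; apply: leq_trans (leq_mul (leqnn _) le_bad) _.
have -> : #|bad| = (#|[pred u : A | has (fun h => h * \val u \notin A)%g P]|
                     * m ^ #|` A|)%N.
  transitivity #|[predX [pred u : A | has (fun h => h * \val u \notin A) P] &
                   {: {ffun A -> 'Z_m}}]|.
    by apply: eq_card => p; rewrite !inE andbT.
  by rewrite cardX card_ffun !card_ord cardfE Zp_cast.
rewrite card_wreath_tile !mulnA leq_mul2r; apply/orP; right.
apply: (@leq_trans (\sum_(h <- P) r k * #|` escaping A h|)).
  rewrite -big_distrr leq_mul2l; apply/orP; right => /=.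
  exact: card_has_escaping.
by rewrite big_distrl /=; apply: leq_sum => h _; exact: eC.
Qed.

(** Light the at most |F k| lamps one at a time, returning to the origin after each; one trip has
    length O([l k]). *)
Lemma length_growth_wreath F l : (forall k, 1 \in F k) ->
  (forall k, 0 < l k)%N -> length_growth F l ->
  length_growth (fun k => wreath_tile (F k)) (fun k => #|` F k| * l k)%N.
Proof.
move=> F1 l_gt0 lF L subL.
have cursorM h h' : cursor_at (Zmod_group m) (h * h') =
  cursor_at (Zmod_group m) h * cursor_at (Zmod_group m) h' by exact: cursor_atM.
have [|C CF] := lF (fun h => L (cursor_at _ h)).
  by move=> x y; rewrite cursorM; exact: subL.
have [|D DF] := lF (fun h => L (cursor_at _ h^-1)).
  by move=> x y; rewrite invgM cursorM addnC; exact: subL.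
pose E := (\max_(a : 'Z_m) L (lamp_at 1 (a : Zmod_group m)))%N.
exists (3 * C + 2 * D + E)%N => k v.
set A := F k; have A_gt0 : (0 < #|` A|)%N.
  by rewrite cardfs_gt0; apply/fset0Pn; exists 1; exact: F1.
(* One trip: two cursors cost [C * l k] each, two inverses [D * l k] each, and the switch at the
   origin [E]. *)
pose K := (2 * (C + D) * l k + E)%N.
have lampK h u a : h \in A -> u \in A -> (L (lamp_at (h * u^-1) a) <= K)%N.
  move=> hA uA; have -> : lamp_at (h * u^-1) a = cursor_at _ h *
      (cursor_at _ u^-1 * (lamp_at 1 a * (cursor_at _ u * cursor_at _ h^-1))).
    by rewrite lamp_at_conj invgM invgK !cursorM !mulgA.
  rewrite (_ : K = C * l k + (D * l k + (E + (C * l k + D * l k))))%N; last first.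
    by rewrite /K; lia.
  apply: leq_trans (subL _ _) (leq_add (CF _ _ hA) _).
  apply: leq_trans (subL _ _) (leq_add (DF _ _ uA) _).
  apply: leq_trans (subL _ _) (leq_add _ _).
    exact: (leq_bigmax (a : 'Z_m)).
  exact: leq_trans (subL _ _) (leq_add (CF _ _ uA) (DF _ _ hA)).
move=> /in_wreath_tile[vA vx].
have : (#|` finsupp (lamps v)| <= #|` A|)%N.
  have inj : injective (fun x => x^-1 * cursor v) by move=> x y /mulIg/invg_inj.
  have <- : #|` [fset x^-1 * cursor v | x in finsupp (lamps v)]| =
      #|` finsupp (lamps v)| by rewrite card_imfset.
  apply/fsubset_leq_card/fsubsetP => _ /imfsetP[x /= + ->].
  by rewrite mem_finsupp => /eqP /vx.
case: v vA vx => f h /= hA; move: #|` A| A_gt0 => n n_gt0 fx fn.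
suff : (L (Wreath f h) <= n * K + C * l k)%N.
  by have := l_gt0 k; rewrite /K; nia.
elim: n f fx fn {n_gt0} => [|n IH] f fx.
  rewrite leqn0 cardfs_eq0 => /eqP f0; rewrite mul0n add0n.
  rewrite (_ : f = [fsfun]); first exact: CF.
  apply/fsfunP => x; rewrite fsfunE; apply/eqP.
  by rewrite -memNfinsupp f0 in_fset0.
have [f0 _|[x xf]] := fset_0Vmem (finsupp f).
  by apply: leq_trans (IH f fx _) _; [rewrite f0 | rewrite mulSn; lia].
rewrite (cardfsD1 x) xf add1n ltnS => fn.
have xA : x^-1 * h \in A by apply: fx; apply/eqP; rewrite -mem_finsupp.
have -> : Wreath f h = lamp_at x (f x) * Wreath [fsfun f with x |-> 1] h.
  apply: wreathP => [y|]; last by rewrite /= mul1g.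
  rewrite wreath_lampsM lamp_atE /= invg1 mul1g fsfun_withE.
  by case: eqP => [->|_]; rewrite ?mulg1 ?mul1g.
apply: leq_trans (subL _ _) _; rewrite mulSn -addnA; apply: leq_add.
  rewrite (_ : x = h * (x^-1 * h)^-1); last by rewrite invgM invgK mulVKg.
  exact: lampK.
apply: IH => [y|].
  by rewrite fsfun_withE; case: eqP => // _; exact: fx.
by rewrite finsupp_with eqxx.
Qed.

End WreathTiles.

(** * Size estimates *)

Section Sizes.
Variables (m : nat) (m_gt1 : (1 < m)%N).

Fixpoint tile_size n k :=
  if n is n'.+1 then tile_size n' k * m ^ tile_size n' k else 2 ^ k.

Fixpoint tile_length n k :=
  if n is n'.+1 then tile_size n' k * tile_length n' k else 2 ^ k.

Lemma exp2_le_tile_size n k : 2 ^ k <= tile_size n k.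
Proof.
elim: n => //= n IH; apply: leq_trans IH _.
by rewrite leq_pmulr// expn_gt0 (ltnW m_gt1).
Qed.

Lemma tile_size_gt0 n k : 0 < tile_size n k.
Proof. by apply: leq_trans (exp2_le_tile_size n k); rewrite expn_gt0. Qed.

Lemma tile_length_gt0 n k : 0 < tile_length n k.
Proof.
by elim: n => [|n IH] /=; rewrite ?expn_gt0// muln_gt0 tile_size_gt0.
Qed.

Lemma tile_size_dvd n k : tile_size n k %| tile_size n k.+1.
Proof.
elim: n => [|n IH] /=; first by rewrite expnS dvdn_mull.
apply: dvdn_mul => //; apply: dvdn_exp2l; apply: dvdn_leq => //.
exact: tile_size_gt0.
Qed.

Lemma tile_sizeS_ge n k : m ^ tile_size n k <= tile_size n.+1 k.
Proof. by rewrite /= leq_pmull// tile_size_gt0. Qed.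

(** The length for n+1 is polynomial in the size for n, hence polylogarithmic in the size for n+1:
    this yields all finite moments. *)
Lemma tile_lengthS_le n k : tile_length n.+1 k <= tile_size n k ^ n.+2.
Proof.
elim: n => [|n IH]; first by rewrite /= expnS expn1.
rewrite [tile_length _ _]/= [leqRHS]expnS leq_mul2l; apply/orP; right.
apply: leq_trans IH _; rewrite leq_exp2r//=.
by rewrite leq_pmulr// expn_gt0 (ltnW m_gt1).
Qed.

Lemma linear_le_exp2 p : exists c, forall k, k.+1 * p <= 2 ^ k + c.
Proof.
(* The bound (k+1)^2 <= 4 * 2^k settles k+1 > 4p; the constant covers smaller k. *)
exists (4 * p * p) => k.
have sq : k.+1 * k.+1 <= 4 * 2 ^ k.
  elim: k => // k IH; have := ltn_expl k (ltnSn 1); rewrite expnS; nia.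
have [kp|pk] := leqP k.+1 (4 * p).
  by rewrite (leq_trans (leq_mul kp (leqnn p))) ?leq_addl.
rewrite (@leq_trans (2 ^ k)) ?leq_addr// -(leq_pmul2l (isT : 0 < 4)).
by apply: leq_trans sq; rewrite mulnCA leq_mul2l (ltnW pk) orbT.
Qed.

(** Induction on [n]: with b = [tile_size n k.+1], the size for n+1 is b m^b <= m^(2b), and its p-th
    power is at most m^(2pb). The induction hypothesis with exponent 2 gives b^2 <= C
    [tile_size n.+1 k], so 2pb is below that size once b > 2pC; smaller b go into the constant. *)
Lemma tile_size_pow n p : exists C, forall k,
  tile_size n k.+1 ^ p <= C * m ^ tile_size n k.
Proof.
elim: n p => [|n IH] p.
  have [c Hc] := linear_le_exp2 p; exists (m ^ c) => k /=.
  rewrite -expnM -expnD addnC (leq_trans (leq_pexp2l _ (Hc k)))//.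
  by case: (posnP (2 ^ k + c)) => [->//|?]; rewrite leq_exp2r.
have [C HC] := IH 2; exists (m ^ (4 * p * p * C)) => k.
have C_gt0 : 0 < C.
  have := HC 0; case: C {HC} => //; rewrite mul0n leqn0 expn_eq0 andbT.
  by rewrite eqn0Ngt tile_size_gt0.
rewrite [tile_size _ k.+1]/=; set b := tile_size n k.+1.
apply: (@leq_trans (m ^ (2 * p * b))).
  apply: (@leq_trans ((m ^ b * m ^ b) ^ p)).
    case: p => // p; rewrite leq_exp2r// leq_mul2r; apply/orP; right.
    exact/ltnW/ltn_expl.
  by rewrite -expnD addnn -mul2n -expnM mulnAC.
rewrite -expnD leq_exp2l//; have [bp|pb] := leqP b (2 * p * C).
  apply: leq_trans (leq_addr _ _).
  apply: leq_trans (leq_mul (leqnn (2 * p)) bp) _; lia.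
apply: leq_trans (leq_addl _ _); rewrite -(leq_pmul2l C_gt0).
apply: (@leq_trans (b ^ 2)).
  by rewrite -mulnn mulnA leq_mul2r mulnC (ltnW pb) orbT.
by apply: leq_trans (HC k) _; rewrite leq_mul2l tile_sizeS_ge orbT.
Qed.

(** The factor 2^k leaves a geometric series after division by the size. For n = 0 length and size
    coincide, whence the condition on [n]. *)
Lemma tile_length_pow n p : 0 < n -> exists C, forall k,
  tile_length n k.+1 ^ p * 2 ^ k <= C * tile_size n k.
Proof.
(* The exponent (n+2)p pays for the p-th power of the length, the additional 1 for the factor
   2^k. *)
case: n => // n _; have [C HC] := tile_size_pow n (n.+2 * p).+1.
exists C => k; apply: leq_trans (_ : _ <= C * m ^ tile_size n k) _; last first.
  by rewrite leq_mul2l tile_sizeS_ge orbT.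
apply: leq_trans (HC k); rewrite [leqRHS]expnSr expnM leq_mul//.
  by case: p {HC} => // p; rewrite leq_exp2r// tile_lengthS_le.
by apply: leq_trans (exp2_le_tile_size _ _); rewrite leq_exp2l.
Qed.

End Sizes.

Local Open Scope classical_set_scope.
Local Open Scope ring_scope.

(** * Iterated logarithms of the sizes and convergence of the series *)

Section Asymptotics.
Variable R : realType.
Local Open Scope ring_scope.
Implicit Types (x y A B eps : R).

Lemma iter_expR_ge n x : x <= iter n expR x.
Proof.
elim: n => //= n IH; apply: le_trans IH _.
have := expR_ge1Dx (iter n expR x); lra.
Qed.

Lemma iter_ln_expR n x : iter n (@ln R) (iter n expR x) = x.
Proof. by elim: n x => // n IH x; rewrite iterSr /= expRK IH. Qed.

(** A factor passes inside an exponential: B exp z = exp(ln B + z) <= exp((1 + ln B) z) for z >= 1,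
    and 1 + ln B goes on inwards. *)
Lemma mul_iter_expR n B : 1 <= B -> exists2 B', 1 <= B' & forall y, 1 <= y ->
  B * iter n expR y <= iter n expR (B' * y).
Proof.
elim: n B => [|n IH] B B1; first by exists B.
have lB : 1 <= 1 + ln B by rewrite lerDl ln_ge0.
have [B' B'1 HB'] := IH _ lB; exists B' => // y y1.
rewrite /= -{1}(lnK (x := B)) ?posrE ?(lt_le_trans ltr01)// -expRD ler_expR.
apply: le_trans (HB' _ y1); have := iter_expR_ge n y.
have := ln_ge0 B1; nra.
Qed.

(** The estimate log^n a_k = O(2^k), stated through exponentials. From a <= exp a follows a m^a <=
    exp((1 + ln m) a), and [mul_iter_expR] moves the factor inside. *)
Lemma tile_size_le_iter_expR m n : (1 < m)%N -> exists2 A, 1 <= A &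
  forall k, (tile_size m n k)%:R <= iter n expR (A * 2 ^+ k) :> R.
Proof.
move=> m1; elim: n => [|n [A A1 HA]].
  by exists 1 => // k; rewrite mul1r natrX.
have m0 : (0 : R) < m%:R by rewrite ltr0n ltnW.
have lm : 0 <= ln (m%:R : R) by rewrite ln_ge0// ler1n ltnW.
have B1 : 1 <= 1 + ln (m%:R : R) by rewrite lerDl.
have [B' B'1 HB'] := mul_iter_expR n B1.
exists (B' * A) => [|k]; first by rewrite mulr_ege1.
have Ak : 1 <= A * 2 ^+ k by rewrite mulr_ege1// exprn_ege1// ler1n.
rewrite -mulrA.
apply: (@le_trans _ _ (expR ((1 + ln m%:R) * (tile_size m n k)%:R))).
  rewrite natrM natrX mulrDl expRD mul1r ler_pM ?exprn_ge0//.
    have := expR_ge1Dx ((tile_size m n k)%:R : R); lra.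
  by rewrite mulrC expRM_natl lnK.
rewrite ler_expR; apply: le_trans (HB' _ Ak).
by rewrite ler_wpM2l// (le_trans ler01).
Qed.

(** A telescoping form of the integral test. With u = 1/(k+2) it reduces to 1 + eps u <= (1 -
    u)^(-eps), which follows from 1 + z <= exp z and ln(1 - u) <= -u. *)
Lemma powR_telescope eps k : 0 < eps ->
  (k.+2%:R `^ (1 + eps))^-1 <=
  eps^-1 * (k.+1%:R `^ (- eps) - k.+2%:R `^ (- eps)) :> R.
Proof.
move=> e0; have k1 : (0 : R) < k.+1%:R by rewrite ltr0n.
have k2 : (0 : R) < k.+2%:R by rewrite ltr0n.
rewrite mulrC ler_pdivlMr// lerBrDr.
rewrite powRD; last by rewrite (gt_eqF k2) implybT.
rewrite powRr1; last exact: ltW.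
rewrite invfM -powRN mulrAC [k.+2%:R^-1 * _]mulrC -[X in _ + X]mul1r -mulrDl.
pose u : R := k.+2%:R^-1; rewrite -/u.
have u0 : 0 < u by rewrite invr_gt0.
have -> : k.+1%:R = k.+2%:R * (1 - u).
  by rewrite mulrBr mulr1 mulfV ?gt_eqF// -(natr1 k.+1) addrK.
have u1 : 0 < 1 - u by rewrite subr_gt0 invf_lt1// ltr1n.
rewrite (powRM _ (ltW k2) (ltW u1)) [leRHS]mulrC ler_pM2r ?powR_gt0//.
rewrite [leRHS]/powR gt_eqF//.
apply: (@le_trans _ _ (expR (eps * u))).
  by have := expR_ge1Dx (eps * u); lra.
rewrite ler_expR mulNr -mulrN ler_pM2l// lerNr.
by have := @le_ln1Dx R (- u); apply; lra.
Qed.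

Lemma powR_sum_bound eps n : 0 < eps ->
  \sum_(k < n) (k.+2%:R `^ (1 + eps))^-1 <= eps^-1 :> R.
Proof.
move=> e0.
apply: le_trans (ler_sum _ (fun (k : 'I_n) _ => powR_telescope k e0)) _.
rewrite -mulr_sumr -[leRHS]mulr1 ler_pM2l ?invr_gt0//.
rewrite -(big_mkord xpredT (fun k => k.+1%:R `^ (- eps) - k.+2%:R `^ (- eps))).
rewrite (telescope_sumr_eq (fun k => - k.+1%:R `^ (- eps)))//; last first.
  by move=> k _; rewrite opprK addrC.
by rewrite opprK powR1 addrC lerBlDr lerDl powR_ge0.
Qed.

Lemma eventually_le_scale (f g : nat -> R) B K : (forall k, 0 <= f k) ->
  (forall k, 0 < g k) -> 0 <= B -> (forall k, (K <= k)%N -> f k <= B * g k) ->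
  exists2 B', 0 <= B' & forall k, f k <= B' * g k.
Proof.
move=> f0 g0 B0 fg; pose B' := \sum_(j < K) f j / g j.
have B'0 : 0 <= B' by apply: sumr_ge0 => j _; rewrite divr_ge0// ltW.
exists (B + B') => [|k]; first exact: addr_ge0.
have [kK|Kk] := ltnP k K; last first.
  by apply: le_trans (fg _ Kk) _; rewrite ler_wpM2r ?lerDl// ltW.
rewrite -ler_pdivrMr// -[leLHS]add0r lerD// /B' (bigD1 (Ordinal kK))//= lerDl.
by apply: sumr_ge0 => j _; rewrite divr_ge0// ltW.
Qed.

(** By monotonicity [psi] may be evaluated at y = exp^n(A 2^(k+1)) >= a_(k+1), where the iterated
    logarithms cancel: the value is A 2^(k+1) / ln(A 2^(k+1))^(1+eps), and this logarithm is at
    least a multiple of k+2. *)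
Lemma represents_phi_sum m n eps (psi : R -> R) : (1 < m)%N -> 0 < eps ->
  represents_phi n eps psi -> exists2 M, 0 <= M & forall N,
    \sum_(k < N) psi (tile_size m n k.+1)%:R / 2 ^+ k <= M.
Proof.
move=> m1 e0 [psi_le psi_ge0 [x0 [_ psiE]]].
have [A A1 aA] := tile_size_le_iter_expR n m1.
have A0 : 0 < A := lt_le_trans ltr01 A1.
have l2 : 0 < ln 2 :> R by rewrite ln_gt0// ltr1n.
(* The half comes from k+1 >= (k+2)/2. *)
pose c : R := ln 2 / 2; have c0 : 0 < c by rewrite divr_gt0.
pose B := 2 * A * (c `^ (1 + eps))^-1.
have B0 : 0 <= B by rewrite mulr_ge0 ?invr_ge0 ?powR_ge0// mulr_ge0// ltW.
have pow2 k : (0 : R) < 2 ^+ k by rewrite exprn_gt0.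
pose g k : R := (k.+2%:R `^ (1 + eps))^-1.
have g0 k : 0 < g k by rewrite invr_gt0 powR_gt0.
have [|||B' B'0 HB'] := @eventually_le_scale
    (fun k => psi (tile_size m n k.+1)%:R / 2 ^+ k) g B (Num.truncn x0).+1 _ _ B0.
- by move=> k; rewrite divr_ge0 ?psi_ge0// ltW.
- exact: g0.
(* For k > x0 also y > x0, so [psi] is given at y by its formula. *)
- move=> k Kk; pose y := iter n expR (A * 2 ^+ k.+1).
  have x0y : x0 < y.
    have : x0 < k%:R by rewrite (lt_le_trans (truncnS_gt x0))// ler_nat.
    move=> /lt_le_trans; apply; apply: le_trans (iter_expR_ge _ _).
    apply: (@le_trans _ _ (2 ^+ k.+1)); last by rewrite ler_peMl// ltW.
    by rewrite -natrX ler_nat (leq_trans (leqnSn k))// ltnW// ltn_expl.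
  apply: (@le_trans _ _ (psi y / 2 ^+ k)).
    by rewrite ler_pM2r ?invr_gt0// psi_le// aA.
  rewrite psiE// /phi_formula iterS iter_ln_expR exprS.
  have lnE : c * k.+2%:R <= ln (A * (2 * 2 ^+ k)).
    rewrite -exprS lnM ?posrE// lnXn// /c.
    have := ln_ge0 A1; rewrite -(natr1 k.+1) -[ln 2 *+ _]mulr_natr.
    have : (1 : R) <= k.+1%:R by rewrite ler1n.
    by nra.
  have : (c `^ (1 + eps)) * k.+2%:R `^ (1 + eps) <=
      ln (A * (2 * 2 ^+ k)) `^ (1 + eps).
    rewrite -(powRM _ (ltW c0))//; apply: ge0_ler_powR => //.
    - by rewrite addr_ge0// ltW.
    - by rewrite nnegrE mulr_ge0// ltW.
    - by rewrite nnegrE (le_trans _ lnE)// mulr_ge0// ltW.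
  set L := ln _ `^ _ => cL.
  have cg : 0 < c `^ (1 + eps) * k.+2%:R `^ (1 + eps).
    by rewrite mulr_gt0 ?powR_gt0.
  rewrite mulrAC [A * _]mulrA mulfK ?gt_eqF// [A * 2]mulrC /B /g.
  rewrite -[leRHS]mulrA -invfM.
  rewrite ler_pM2l ?mulr_gt0// lef_pV2 ?posrE//.
  exact: lt_le_trans cL.
exists (B' * eps^-1) => [|N]; first by rewrite mulr_ge0// invr_ge0 ltW.
apply: le_trans (ler_sum _ (fun (k : 'I_N) _ => HB' k)) _.
by rewrite -mulr_sumr ler_wpM2l// powR_sum_bound.
Qed.

End Asymptotics.

(** * The action of a tiled group on the unit interval *)

Section Cells.
Variables (R : realType) (a : nat -> nat).
Hypothesis a_gt0 : forall k, (0 < a k)%N.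

Definition cell k i : set R := [set` `[i%:R / (a k)%:R, i.+1%:R / (a k)%:R[].

Definition cell_shift k (i j : nat) : R := (j%:R - i%:R) / (a k)%:R.

Let a_pos k : 0 < (a k)%:R :> R. Proof. by rewrite ltr0n. Qed.

Lemma cellE k i x : cell k i x <-> i%:R <= x * (a k)%:R < i.+1%:R.
Proof. by rewrite /cell /= in_itv /= ler_pdivrMr// ltr_pdivlMr. Qed.

Lemma cell_inj k i j x : cell k i x -> cell k j x -> i = j.
Proof. by move=> /cellE/truncn_def <- /cellE/truncn_def. Qed.

Lemma cell_unit k i x : (i < a k)%N -> cell k i x -> 0 <= x < 1.
Proof.
move=> ia /cellE/andP[ix xi]; apply/andP; split.
  by rewrite -(pmulr_lge0 _ (a_pos k)) (le_trans _ ix).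
rewrite -(ltr_pM2r (a_pos k)) mul1r (lt_le_trans xi)//.
by rewrite ler_nat.
Qed.

Lemma cell_ex k x : 0 <= x < 1 -> exists2 i, (i < a k)%N & cell k i x.
Proof.
move=> /andP[x0 x1]; have xa0 : 0 <= x * (a k)%:R by rewrite mulr_ge0// ltW.
exists (Num.truncn (x * (a k)%:R)); last by apply/cellE; exact: truncn_itv.
by rewrite truncn_lt_nat// gtr_pMl.
Qed.

Lemma cell_shiftP k i j x : cell k i x -> cell k j (x + cell_shift k i j).
Proof.
move=> /cellE ix; apply/cellE.
rewrite mulrDl /cell_shift mulfVK ?gt_eqF//.
move: ix; rewrite -!natr1; lra.
Qed.

Lemma cell_shiftK k i j x : x + cell_shift k i j + cell_shift k j i = x.
Proof. by rewrite /cell_shift; lra. Qed.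

Lemma cell_shiftD k i j l :
  cell_shift k i j + cell_shift k j l = cell_shift k i l.
Proof. by rewrite /cell_shift; lra. Qed.

Lemma cell_shift0 k i : cell_shift k i i = 0.
Proof. by rewrite /cell_shift subrr mul0r. Qed.

Lemma cell_split k q i x : (0 < q)%N -> a k.+1 = (a k * q)%N ->
  cell k i x -> exists2 d, (d < q)%N & cell k.+1 (i * q + d) x.
Proof.
move=> q0 aq /cellE /andP[ix xi]; have xa0 := le_trans (ler0n R i) ix.
have q0' : 0 < q%:R :> R by rewrite ltr0n.
have xaq : 0 <= x * (a k.+1)%:R by rewrite aq natrM mulrA mulr_ge0.
set n := Num.truncn (x * (a k.+1)%:R).
have [nx xn] := andP (truncn_itv xaq).
have iq : (i * q <= n)%N.
  by rewrite truncn_ge_nat// aq !natrM mulrA ler_pM2r.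
have ni : (n < i.+1 * q)%N.
  by rewrite truncn_lt_nat// aq !natrM mulrA ltr_pM2r.
exists (n - i * q)%N; first by rewrite ltn_subLR// -mulSnr.
by rewrite subnKC//; apply/cellE/andP.
Qed.

(** The common digit cancels: refinement does not change the translation, so the levels of the
    action agree. *)
Lemma cell_shift_split k q i j d : (0 < q)%N -> a k.+1 = (a k * q)%N ->
  cell_shift k.+1 (i * q + d) (j * q + d) = cell_shift k i j.
Proof.
move=> q0 aq; rewrite /cell_shift aq !natrD opprD addrACA subrr addr0 !natrM -mulrBl.
by rewrite -mulf_div divff ?mulr1// pnatr_eq0 -lt0n.
Qed.

End Cells.

(** * Partial translations at finite levels and the action they define *)

Section Reach.
Variables (R : realType) (a : nat -> nat).
Hypothesis a_gt0 : forall k, (0 < a k)%N.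
Variables (H : groupType) (F : nat -> {fset H}) (t : nat -> nat -> H).
Hypothesis tP : tile_enum a F t.
Implicit Types (x y : R) (g h : H).
Local Notation cell := (@cell R a).
Local Notation shift := (@cell_shift R a).

(** The graph of the partial bijection that [h] induces at level [k]; a relation, since nothing is
    defined on escaping cells. *)
Definition reach k h x y := exists i j,
  [/\ (i < a k)%N, (j < a k)%N, cell k i x, t k j = (h * t k i)%g &
      y = x + shift k i j].

(** The new digit is a right factor, untouched by left multiplication by [h]. *)
Lemma reachS k h x y : reach k h x y -> reach k.+1 h x y.
Proof.
move=> [i [j [ia ja ix hij ->]]].
have [q [s [q0 aq ts]]] := tile_enum_step tP k.
have [d dq dx] := cell_split a_gt0 q0 aq ix.
have below l : (l < a k)%N -> (l * q + d < a k.+1)%N.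
  move=> la; rewrite aq; apply: (@leq_trans (l.+1 * q)%N).
    by rewrite mulSnr ltn_add2l.
  by rewrite leq_mul2r la orbT.
exists (i * q + d)%N, (j * q + d)%N; split => //; rewrite ?below//.
  by rewrite !ts !divnMDl// divn_small// !addn0 !modnMDl modn_small// hij mulgA.
by rewrite cell_shift_split.
Qed.

Lemma reach_le k l h x y : (k <= l)%N -> reach k h x y -> reach l h x y.
Proof.
move=> /subnK <-; elim: (l - k)%N => // n IH kxy.
by rewrite addSn; apply: reachS; exact: IH.
Qed.

Lemma reach_fun_level k h x y y' : reach k h x y -> reach k h x y' -> y = y'.
Proof.
move=> [i [j [ia ja ix hij ->]]] [i' [j' [ia' ja' ix' hij' ->]]].
have ii' := cell_inj a_gt0 ix ix'; rewrite -ii' in hij' *.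
by have -> : j = j' by apply: (tile_enum_inj tP) (etrans hij (esym hij')).
Qed.

Lemma reach_fun k l h x y y' : reach k h x y -> reach l h x y' -> y = y'.
Proof.
move=> /(reach_le (leq_maxl k l)) xy /(reach_le (leq_maxr k l)).
exact: reach_fun_level.
Qed.

Lemma reach1 k x : 0 <= x < 1 -> reach k 1%g x x.
Proof.
move=> /(cell_ex a_gt0 k)[i ia ix]; exists i, i; split => //.
  by rewrite mul1g.
by rewrite cell_shift0 addr0.
Qed.

Lemma reachM k g h x y z :
  reach k h x y -> reach k g y z -> reach k (g * h)%g x z.
Proof.
move=> [i [j [ia ja ix hij ->]]] [j' [l [ja' la jx gjl ->]]].
have jj' := cell_inj a_gt0 jx (cell_shiftP a_gt0 j ix).
rewrite jj' in gjl *; exists i, l; split => //.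
  by rewrite gjl hij mulgA.
by rewrite -addrA cell_shiftD.
Qed.

Lemma reachV k h x y : reach k h x y -> reach k h^-1%g y x.
Proof.
move=> [i [j [ia ja ix hij ->]]]; exists j, i; split => //.
- exact: cell_shiftP.
- by rewrite hij mulKg.
- by rewrite cell_shiftK.
Qed.

Lemma reach_unit k h x y : reach k h x y -> 0 <= x < 1.
Proof. by move=> [i [j [ia _ ix _ _]]]; exact: cell_unit ix. Qed.

Lemma reach_free k h x : reach k h x x -> h = 1%g.
Proof.
move=> [i [j [ia ja ix hij]]]; rewrite -[LHS]addr0 => /addrI/esym ij0.
have : x + shift k i j = x by rewrite ij0 addr0.
have := cell_shiftP a_gt0 j ix => /[swap] ->; move=> jx.
have ij := cell_inj a_gt0 ix jx; rewrite -ij in hij.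
by apply: (@mulIg _ (t k i)); rewrite mul1g -hij.
Qed.

(* The relation "same level-k block" depends on the block sizes only: this is
   why two groups tiled with the same block sizes have the same orbits. *)
Definition same_block k x y := exists i j,
  [/\ (i < a k)%N, (j < a k)%N, cell k i x & y = x + shift k i j].

Lemma reach_block k h x y : reach k h x y -> same_block k x y.
Proof. by move=> [i [j [ia ja ix _ ->]]]; exists i, j. Qed.

Lemma block_reach k x y : same_block k x y ->
  exists u v, [/\ u \in F k, v \in F k & reach k (u * v^-1)%g x y].
Proof.
move=> [i [j [ia ja ix xy]]]; exists (t k j), (t k i).
split; try exact: (tile_enum_mem tP).
by exists i, j; split => //; rewrite mulgVK.
Qed.

Definition escape_set k h : set R :=
  [set x | exists2 i, (i < a k)%N /\ cell k i x & (h * t k i)%g \notin F k].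

Lemma reach_or_escape k h x : 0 <= x < 1 ->
  (exists y, reach k h x y) \/ escape_set k h x.
Proof.
move=> /(cell_ex a_gt0 k)[i ia ix].
have [hF|hF] := boolP ((h * t k i)%g \in F k); last by right; exists i.
by left; have [j ja jE] := tile_enum_surj tP hF; exists (x + shift k i j), i, j.
Qed.

Definition regular x := 0 <= x < 1 /\ forall h, exists k y, reach k h x y.

(* On the null set of irregular points we let the group act trivially, so that
   the action axioms hold everywhere. *)
Definition tile_act h x : R :=
  if `[< regular x >] then xget x [set y | exists k, reach k h x y] else x.

Lemma tile_act_reach k h x y : regular x -> reach k h x y -> tile_act h x = y.
Proof.
move=> rx xy; rewrite /tile_act (asboolT rx).
case: xgetP => [z _ [l xz]|/(_ y) []]; last by exists k.
exact: reach_fun xz xy.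
Qed.

Lemma tile_actP h x : regular x -> exists k, reach k h x (tile_act h x).
Proof.
move=> rx; have [k [y xy]] := rx.2 h.
by exists k; rewrite (tile_act_reach rx xy).
Qed.

Lemma tile_act_irregular h x : ~ regular x -> tile_act h x = x.
Proof. by move=> nrx; rewrite /tile_act asboolF. Qed.

(** If w carries x to y, then h sends y where h w sends x. *)
Lemma regular_block k x y : same_block k x y -> regular x -> regular y.
Proof.
move=> /block_reach[u [v [_ _ xy]]] rx; split.
  by have := reach_unit (reachV xy).
move=> h; have [l [z xz]] := rx.2 (h * (u * v^-1))%g.
exists (maxn k l), z; have := reachM (reach_le (leq_maxl k l) (reachV xy))
  (reach_le (leq_maxr k l) xz).
by rewrite mulgK.
Qed.

Lemma tile_act_regular h x : regular (tile_act h x) <-> regular x.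
Proof.
have [rx|nrx] := pselect (regular x); last by rewrite tile_act_irregular.
split => // _; have [k /reach_block xy] := tile_actP h rx.
exact: regular_block xy rx.
Qed.

Lemma tile_act1 x : tile_act 1%g x = x.
Proof.
have [rx|nrx] := pselect (regular x); last exact: tile_act_irregular.
exact: tile_act_reach rx (reach1 0 rx.1).
Qed.

Lemma tile_actM g h x : tile_act (g * h)%g x = tile_act g (tile_act h x).
Proof.
have [rx|nrx] := pselect (regular x); last by rewrite !tile_act_irregular.
have [k xy] := tile_actP h rx.
have [l yz] := tile_actP g ((tile_act_regular h x).2 rx).
apply: tile_act_reach rx (reachM (reach_le (leq_maxl k l) xy) _).
exact: reach_le (leq_maxr k l) yz.
Qed.

Lemma orbit_tile_act x : regular x ->
  @Defs.orbit _ (measurableTypeR R) H tile_act x =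
  [set y | exists k, same_block k x y].
Proof.
move=> rx; apply/seteqP; split => [_ [h _ <-]|y [k /block_reach[u [v [_ _ xy]]]]].
  by have [k /reach_block] := tile_actP h rx; exists k.
by exists (u * v^-1)%g => //; exact: tile_act_reach xy.
Qed.

Lemma tile_act_free x : regular x -> forall h, tile_act h x = x -> h = 1%g.
Proof.
by move=> rx h hx; have [k] := tile_actP h rx; rewrite hx => /reach_free.
Qed.

End Reach.

(** * Lebesgue measure on the unit interval *)

Section UnitMeasure.
Variable R : realType.

Lemma measurable_addr (c : R) :
  measurable_fun setT (fun x : measurableTypeR R => x + c : measurableTypeR R).
Proof. by apply: measurable_funD => //; exact: measurable_cst. Qed.

Lemma lebesgue_measure_addr (c : R) (A : set R) : measurable A ->
  lebesgue_measure [set x | A (x + c)] = lebesgue_measure A.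
Proof.
move=> mA; pose f (x : measurableTypeR R) : measurableTypeR R := x + c.
have mf : measurable_fun setT f by exact: measurable_addr.
pose fm := isMeasurableFun.Build _ _ _ _ f mf.
pose F : {mfun _ >-> _} := HB.pack f fm.
pose nu := pushforward lebesgue_measure F.
apply/esym; apply: (lebesgue_measure_unique (mu := nu)) => //.
move=> _ [[u v]] _ <-.
transitivity (lebesgue_measure `]u - c, v - c]%classic).
  rewrite !lebesgue_measure_itv /= !lte_fin ltrD2r; case: ifP => // _.
  by rewrite -!EFinD; congr (_%:E); lra.
congr (lebesgue_measure _); apply/seteqP.
by split => x /=; rewrite !in_itv /= ltrBlDr lerBrDr.
Qed.

(** The space is the whole real line with mass on [0, 1[ only; outside, all points are irregular and
    the groups act trivially. *)
Definition unit_measure : set (measurableTypeR R) -> \bar R :=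
  mrestr lebesgue_measure (measurable_itv `[0%R, 1%R[).

HB.instance Definition _ := Measure.on unit_measure.

Lemma unit_measure_setT : unit_measure setT = 1%E.
Proof.
rewrite /unit_measure /mrestr setTI lebesgue_measure_itv /= lte_fin ltr01.
by rewrite oppr0 adde0.
Qed.

HB.instance Definition _ :=
  Measure_isProbability.Build _ _ _ unit_measure unit_measure_setT.

Lemma standard_borel_measurableTypeR : standard_borel R (measurableTypeR R).
Proof.
exists R, idfun; split.
- exact: order_hausdorff.
- exists (range (@ratr R)).
    exact: (card_le_trans (card_image_le _ _) (countableP _)).
  exact: dense_rat.
- by exists idfun.
- rewrite /preimage_set_system; apply/seteqP; split => [A mA|_ [B + <-]].
    exists A; last by rewrite setTI.
    move: mA; have := RGenOpens.measurableE R; rewrite /= => ->.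
    apply: sub_smallest2r; first exact: smallest_sigma_algebra.
    by move=> _ [u [v ->]]; exact: interval_open.
  rewrite setTI; apply: smallest_sub; first exact: sigma_algebra_measurable.
  exact: open_measurable.
Qed.

End UnitMeasure.

(** * Measurability and invariance of the action *)

Section TileActMeasure.
Variables (R : realType) (a : nat -> nat) (H : groupType) (F : nat -> {fset H}).
Variables (t : nat -> nat -> H) (r : nat -> nat) (e : nat -> H).
Hypothesis card_F : forall k, #|` F k| = a k.
Hypothesis a_gt0 : forall k, (0 < a k)%N.
Hypothesis tP : tile_enum a F t.
Hypothesis rP : escape_rate F r.
Hypothesis r_gt : forall k, (k < r k)%N.
Hypothesis e_surj : forall h, exists n, e n = h.
Implicit Types (x y : R) (g h : H).
Local Notation cell := (@cell R a).
Local Notation shift := (@cell_shift R a).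
Local Notation mu := (@unit_measure R).
Local Notation T := (measurableTypeR R).
Local Notation act := (@tile_act R a H t).
Local Notation escape_set := (@escape_set R a H F t).

Let a_pos k : 0 < (a k)%:R :> R. Proof. by rewrite ltr0n. Qed.

Lemma measurable_cell k i : measurable (cell k i : set T).
Proof. exact: measurable_itv. Qed.

Lemma cell_sub_unit k i : (i < a k)%N -> cell k i `<=` [set` `[0, 1[].
Proof. by move=> ia x /(cell_unit a_gt0 ia); rewrite /= in_itv. Qed.

Lemma measure_cell k i : (i < a k)%N -> mu (cell k i) = ((a k)%:R^-1)%:E.
Proof.
move=> ia; rewrite /unit_measure /mrestr setIidl; last exact: cell_sub_unit.
rewrite lebesgue_measure_itv /= lte_fin ltr_pM2r ?invr_gt0// ltr_nat ltnSn.
by rewrite -EFinD -mulrBl -natr1 addrAC subrr add0r mul1r.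
Qed.


Lemma measure_escape_set k h :
  (mu (escape_set k h) <= (#|` escaping (F k) h|%:R / (a k)%:R)%:E)%E.
Proof.
pose D := [fset i | i in iota 0 (a k) & (h * t k i)%g \notin F k]%fset.
have inD i : i \in D = (i < a k)%N && ((h * t k i)%g \notin F k).
  by rewrite !inE mem_iota.
have -> : escape_set k h = \bigcup_(i in [set` D]) cell k i.
  apply/seteqP; split => [x [i [ia ix] hi]|x [i]].
    by exists i; rewrite //= inD ia.
  by rewrite /= inD => /andP[ia hi] ix; exists i.
have Dfin : finite_set [set` D] by exact: finite_fset.
apply: (le_trans (content_sub_fsum mu Dfin _ _ (fun x => id))).
- by move=> i _; exact: measurable_cell.
- by apply: fin_bigcup_measurable => // i _; exact: measurable_cell.
rewrite fsbig_finite//= set_fsetK.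
apply: (@le_trans _ _ (\sum_(i <- D) ((a k)%:R^-1)%:E)%E).
  rewrite big_seq [leRHS]big_seq; apply: lee_sum => i.
  by rewrite inD => /andP[ia _]; rewrite measure_cell.
rewrite sumEFin lee_fin big_const_seq count_predT iter_addr_0 -[leLHS]mulr_natl.
rewrite ler_pM2r ?invr_gt0// ler_nat.
have <- : #|` [fset t k i | i in D]%fset| = #|` D|.
  rewrite card_in_imfset// => i j; rewrite !inD => /andP[ia _] /andP[ja _].
  exact: (tile_enum_inj tP ia ja).
apply/fsubset_leq_card/fsubsetP => _ /imfsetP[i /= + ->].
by rewrite inD !inE => /andP[/(tile_enum_mem tP) -> ->].
Qed.

Lemma measurable_escape_set k h : measurable (escape_set k h : set T).
Proof.
rewrite (_ : escape_set k h = \bigcup_(i in [set i | (i < a k)%N /\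
    (h * t k i)%g \notin F k]) cell k i).
  by apply: bigcup_measurable => i _; exact: measurable_cell.
apply/seteqP; split => [x [i [ia ix] hi]|x [i [ia hi] ix]].
  by exists i.
by exists i.
Qed.

Lemma measure_escape_set_le h : exists C : nat, forall k,
  (mu (escape_set k h) <= (C%:R / (r k)%:R)%:E)%E.
Proof.
have [C rC] := rP h; exists C => k; apply: le_trans (measure_escape_set k h) _.
have r0 : (0 < r k)%N by rewrite (leq_ltn_trans _ (r_gt k)).
rewrite lee_fin ler_pdivrMr// mulrAC ler_pdivlMr ?ltr0n//.
by rewrite -!natrM ler_nat mulnC -card_F rC.
Qed.

Lemma small_escape h (eps : R) : 0 < eps ->
  exists k, (mu (escape_set k h) <= eps%:E)%E.
Proof.
move=> eps0; have [C mC] := measure_escape_set_le h.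
(* For this k, C / eps < k+1 <= [r k]. *)
exists (Num.truncn (C%:R / eps)); set k := Num.truncn _.
apply: le_trans (mC k) _; rewrite lee_fin.
rewrite ler_pdivrMr ?ltr0n ?(leq_ltn_trans _ (r_gt k))//.
rewrite -ler_pdivrMl// mulrC.
have /andP[_ /ltW] : k%:R <= C%:R / eps < k.+1%:R.
  by rewrite truncn_itv// divr_ge0// ltW.
by move=> /le_trans; apply; rewrite ler_nat.
Qed.

(** The complement of [regular], written with countable operations on escape sets to be measurable;
    it is null because each group element has arbitrarily small escape sets. *)
Definition irregular : set T :=
  ~` [set` `[0, 1[] `|` \bigcup_n \bigcap_k escape_set k (e n).

Lemma irregularE x : irregular x <-> ~ regular a t x.
Proof.
split=> [[x01|[n _ nx]]|].
- by move=> [+ _]; move: x01; rewrite /= in_itv.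
- move=> [_ /(_ (e n))[k [y [i [j [ia ja ix hij _]]]]]].
  have [i' [ia' ix'] /negP] := nx k I; apply.
  by rewrite -(cell_inj a_gt0 ix ix') -hij; exact: (tile_enum_mem tP).
apply: contra_notP => /not_orP[x01 nx]; split.
  by move: x01; rewrite /= in_itv /= => /contrapT.
move=> h; have [n <-] := e_surj h; apply: contra_notP nx => nx.
exists n => // k _; have x01' : 0 <= x < 1.
  by move: x01; rewrite /= in_itv /= => /contrapT.
case: (reach_or_escape a_gt0 tP k (e n) x01') => // -[y xy].
by exfalso; apply: nx; exists k, y.
Qed.

Lemma measurable_irregular : measurable irregular.
Proof.
apply: measurableU; first by apply: measurableC; exact: measurable_itv.
apply: bigcupT_measurable => n; apply: bigcapT_measurable => k.
exact: measurable_escape_set.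
Qed.

Lemma measure_irregular : mu irregular = 0%E.
Proof.
have out0 : mu (~` [set` `[0, 1[]) = 0%E.
  by rewrite /unit_measure /mrestr setICl measure0.
apply: measure_negligible; first exact: measurable_irregular.
apply: negligibleU.
  apply/negligibleP; first by apply: measurableC; exact: measurable_itv.
  exact: out0.
apply: negligible_bigcup => n.
have mE : measurable (\bigcap_k escape_set k (e n) : set T).
  by apply: bigcapT_measurable => k; exact: measurable_escape_set.
apply/negligibleP; first exact: mE.
apply/eqP; rewrite eq_le measure_ge0 andbT.
apply/lee_addgt0Pr => eps eps0; rewrite add0e.
have [k] := small_escape (e n) eps0; apply: le_trans.
apply: le_measure; rewrite ?inE//; first exact: measurable_escape_set.
exact: bigcap_inf.
Qed.

Lemma regular_ae : {ae mu, forall x, regular a t x}.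
Proof.
exists irregular; split.
- exact: measurable_irregular.
- exact: measure_irregular.
- by move=> x /= /irregularE.
Qed.

Definition target k h i :=
  xget 0%N [set j | (j < a k)%N /\ t k j = (h * t k i)%g].

Lemma targetP k h i : (h * t k i)%g \in F k ->
  (target k h i < a k)%N /\ t k (target k h i) = (h * t k i)%g.
Proof.
move=> /(tile_enum_surj tP)[j ja jE]; rewrite /target.
by case: xgetP => [l _ //|/(_ j)[]].
Qed.

Definition moved k h (A : set T) i : set T :=
  cell k i `&` [set x | A (x + shift k i (target k h i))].

Lemma measurable_moved k h A i : measurable A -> measurable (moved k h A i).
Proof.
move=> mA; apply: measurableI; first exact: measurable_cell.
by rewrite -[X in measurable X]setTI; exact: measurable_addr.
Qed.

Lemma preimage_tile_act h A : act h @^-1` A =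
  (irregular `&` A) `|` (~` irregular `&` \bigcup_k
    \bigcup_(i in [set i | (i < a k)%N /\ (h * t k i)%g \in F k]) moved k h A i).
Proof.
apply/seteqP; split => [x /= xA|x [[/irregularE nrx xA]|[/irregularE/contrapT rx]]].
- have [rx|nrx] := pselect (regular a t x); last first.
    left; split; first exact/irregularE.
    by move: xA; rewrite tile_act_irregular.
  right; split; first by move=> /irregularE.
  have [k [i [j [ia ja ix hij xy]]]] := tile_actP a_gt0 tP h rx.
  have hF : (h * t k i)%g \in F k by rewrite -hij; exact: (tile_enum_mem tP).
  exists k => //; exists i => //; split => //=.
  have [la lE] := targetP hF.
  rewrite (_ : target k h i = j) -?xy//.
  by apply: (tile_enum_inj tP la ja); rewrite lE hij.
- by rewrite /= tile_act_irregular.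
- move=> [k _ [i [ia hF] [ix xA]]]; have [la lE] := targetP hF.
  rewrite /= (_ : act h x = x + shift k i (target k h i))//.
  by apply: (tile_act_reach a_gt0 tP rx (k := k)); exists i, (target k h i).
Qed.

Lemma measurable_tile_act h : measurable_fun setT (act h : T -> T).
Proof.
move=> _ A mA; rewrite setTI preimage_tile_act.
have mI := measurable_irregular.
apply: measurableU; first exact: measurableI.
apply: measurableI; first exact: measurableC.
apply: bigcupT_measurable => k; apply: bigcup_measurable => i _.
exact: measurable_moved.
Qed.

Lemma measure_moved k h A i : measurable A -> (i < a k)%N ->
  (h * t k i)%g \in F k -> mu (moved k h A i) = mu (cell k (target k h i) `&` A).
Proof.
move=> mA ia hF; have [la lE] := targetP hF.
rewrite /unit_measure /mrestr.
rewrite (setIidl (A := moved k h A i)); last first.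
  by move=> x [ix _]; exact: (cell_sub_unit ia ix).
rewrite (setIidl (A := cell k (target k h i) `&` A)); last first.
  by move=> x [ix _]; exact: (cell_sub_unit la ix).
rewrite -[RHS](lebesgue_measure_addr (shift k i (target k h i))); last first.
  by apply: measurableI => //; exact: measurable_cell.
congr (lebesgue_measure _); apply/seteqP; split => x [ix xA]; split => //.
  exact: cell_shiftP.
by rewrite -(cell_shiftK a k i (target k h i) x); exact: cell_shiftP.
Qed.

(* Applied to h and to h^-1, this inequality gives the invariance of mu. *)
Lemma measure_tile_act_le h A : measurable A -> (mu (act h @^-1` A) <= mu A)%E.
Proof.
move=> mA; apply/lee_addgt0Pr => eps eps0.
have [k small] := small_escape h eps0.
pose D := [set i | (i < a k)%N /\ (h * t k i)%g \in F k].
have Dfin : finite_set D by apply: (sub_finite_set _ (finite_II (a k))) => i [].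
have mM i : measurable (moved k h A i) by exact: measurable_moved.
have mU : measurable (\bigcup_(i in D) moved k h A i) by exact: bigcup_measurable.
have mI := measurable_irregular; have mE := measurable_escape_set k h.
(* Up to a null set, the preimage is covered by the pieces that level [k] translates and by the
   escape set, of measure at most [eps]. *)
apply: (@le_trans _ _
  (mu (\bigcup_(i in D) moved k h A i `|` escape_set k h `|` irregular))%E).
  apply: le_measure; rewrite ?inE; last 1 first.
  - move=> x xA; have [rx|nrx] := pselect (regular a t x); last first.
      by right; exact/irregularE.
    left; case: (reach_or_escape a_gt0 tP k h rx.1) => [[y xy]|]; last by right.
    left; have xy' := tile_act_reach a_gt0 tP rx xy.
    have [i [j [ia ja ix hij yE]]] := xy.
    have hF : (h * t k i)%g \in F k by rewrite -hij; exact: (tile_enum_mem tP).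
    exists i => //; split => //=; have [la lE] := targetP hF.
    rewrite (_ : target k h i = j) -?yE -?xy'//.
    by apply: (tile_enum_inj tP la ja); rewrite lE hij.
  - by rewrite -[X in measurable X]setTI; exact: measurable_tile_act.
  - by apply: measurableU => //; exact: measurableU.
rewrite measureU0//; [|exact: measurableU|exact: measure_irregular].
apply: (le_trans (measureU2 _ _ _)) => //; apply: leeD => //.
apply: (le_trans (content_sub_fsum mu Dfin _ mU (fun x => id))) => //.
rewrite (eq_fsbigr (fun i => mu (cell k (target k h i) `&` A))); last first.
  by move=> i; rewrite inE => -[ia hF]; exact: measure_moved.
have mC i : measurable (cell k (target k h i) `&` A).
  by apply: measurableI => //; exact: measurable_cell.
(* Distinct cells have distinct targets, so the translated pieces are disjoint parts of [A]. *)
rewrite -(measure_fin_bigcup mu Dfin _ (fun i _ => mC i)); last first.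
  move=> i j [ia iF] [ja jF] [x [[ix _] [jx _]]].
  have [la lE] := targetP iF; have [la' lE'] := targetP jF.
  apply: (tile_enum_inj tP ia ja); apply: (mulgI h).
  by rewrite -lE -lE' (cell_inj a_gt0 ix jx).
apply: le_measure; rewrite ?inE//.
  by apply: bigcup_measurable => i _; exact: mC.
by move=> x [i _ []].
Qed.

Lemma tile_act_preserving h A : measurable A -> mu (act h @^-1` A) = mu A.
Proof.
move=> mA; apply/eqP; rewrite eq_le measure_tile_act_le//=.
have mhA : measurable (act h @^-1` A).
  by rewrite -[X in measurable X]setTI; exact: measurable_tile_act.
apply: le_trans (measure_tile_act_le h^-1%g mhA).
rewrite le_eqVlt; apply/orP; left; apply/eqP; congr (mu _).
apply/seteqP; split => x /=;
  by rewrite -(tile_actM a_gt0 tP) mulgV (tile_act1 a_gt0 tP).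
Qed.

Lemma pmp_free_tile_act : pmp_free_action mu (act : H -> T -> T).
Proof.
split.
- exact: tile_act1 tP.
- exact: tile_actM tP.
- exact: measurable_tile_act.
- exact: tile_act_preserving.
- apply: negligibleS regular_ae => x; apply: contra_not => rx.
  exact: (tile_act_free a_gt0 tP rx).
Qed.

End TileActMeasure.

(** * Integrability *)

Section WordLengths.
Variables (G : groupType) (S : set G).
Hypothesis genS : finite_symmetric_generating S.
Local Open Scope group_scope.

Lemma min_natP (A : set nat) : A !=set0 ->
  A (min_nat A) /\ forall n, A n -> (min_nat A <= n)%N.
Proof.
move=> [n An]; have /ex_minnP[l /asboolP Al minl] : exists n, `[< A n >].
  by exists n; exact/asboolP.
rewrite /min_nat; case: xgetP => [k _ [Ak mink]//|/(_ l)[]].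
by split => // j /asboolP; exact: minl.
Qed.

Lemma min_nat0 : min_nat set0 = 0%N.
Proof. by rewrite /min_nat; case: xgetP => // k _ []. Qed.

Lemma word_lengthP g : exists2 w, words S g w & size w = word_length S g.
Proof.
have [_ _ /(_ g) [w wg]] := genS.
have [[v vg vl] _] := min_natP (image_nonempty size (ex_intro _ w wg)).
by exists v.
Qed.

Lemma word_length_le g w : words S g w -> (word_length S g <= size w)%N.
Proof.
move=> wg; have [_] := min_natP (image_nonempty size (ex_intro _ w wg)).
by apply; exists w.
Qed.

Lemma word_length1 : word_length S 1 = 0%N.
Proof.
apply/eqP; rewrite -leqn0; apply: (@word_length_le _ [::]).
by split => //; rewrite big_nil.
Qed.

Lemma word_length_subadditive : subadditive_length (word_length S).
Proof.
move=> x y; have [v [Sv vx] <-] := word_lengthP x.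
have [w [Sw wy] <-] := word_lengthP y.
rewrite -size_cat; apply: word_length_le; split; last by rewrite big_cat vx wy.
by move=> s; rewrite mem_cat => /orP[/Sv|/Sw].
Qed.

Lemma word_length_growth (F : nat -> {fset G}) l : length_growth F l ->
  exists C, forall k u v, u \in F k -> v \in F k ->
    (word_length S (u * v^-1)%g <= C * l k)%N.
Proof.
move=> lF; have [C CF] := lF _ word_length_subadditive.
have [|D DF] := lF (fun g => word_length S g^-1).
  by move=> x y; rewrite invgM addnC; exact: word_length_subadditive.
exists (C + D)%N => k u v uF vF; apply: leq_trans (word_length_subadditive _ _) _.
by rewrite mulnDl leq_add// ?CF ?DF.
Qed.

Lemma finite_symmetric_generating_enum :
  exists e : nat -> G, forall g, exists n, e n = g.
Proof.
have [/finite_seqP[s Ss] _ _] := genS.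
exists (fun n => if @choice.unpickle (seq nat) n is Some w
  then \prod_(i <- w) nth 1 s i else 1).
move=> g; have [w [Sw <-] _] := word_lengthP g.
exists (@choice.pickle (seq nat) [seq index i s | i <- w]).
rewrite choice.pickleK big_map.
rewrite big_seq [RHS]big_seq; apply: eq_bigr => i /Sw.
by rewrite Ss => /nth_index ->.
Qed.

End WordLengths.

Section IntegralBound.
Context d (T : measurableType d) (R : realType) (mu : probability T R).
Local Open Scope ereal_scope.

(* The integral of a nonnegative function is a supremum over the simple functions
   below it; this avoids the measurability of x |-> orbit_dist S b x (a g x). *)
Lemma ge0_le_integralT (f g : T -> \bar R) : (forall x, 0 <= f x) ->
  (forall x, f x <= g x) -> \int[mu]_x f x <= \int[mu]_x g x.
Proof.
move=> f0 fg; rewrite !ge0_integralTE//; last by move=> x; exact: le_trans (fg x).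
apply: ereal_sup_le => _ [h hf <-]; exists h => // x.
exact: le_trans (hf x) (fg x).
Qed.

(** [f] is dominated by the measurable function [G], the constant [V 0] plus the indicators of the
    [E k] weighted by [V k.+1], which is integrated term by term. *)
Lemma integral_layers_lty (f : T -> R) (V b : nat -> R) (E : nat -> set T) (M : R) :
  (forall x, 0 <= f x)%R -> (forall k, 0 <= V k)%R ->
  (forall k, measurable (E k)) -> (forall k, mu (E k) <= (b k)%:E) ->
  (forall n, \sum_(k < n) V k.+1 * b k <= M)%R ->
  (forall x, (f x <= V 0%N)%R \/ exists2 k, E k x & (f x <= V k.+1)%R) ->
  \int[mu]_x (f x)%:E < +oo.
Proof.
move=> f0 V0 mE mub VbM fV.
pose g k (x : T) := (V k.+1)%:E * (\1_(E k) x)%:E.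
have g0 k x : 0 <= g k x by rewrite /g -EFinM lee_fin mulr_ge0// indicE.
have mg k : measurable_fun setT (g k).
  by apply: measurable_funeM; apply/measurable_EFinP; exact: measurable_indic.
pose G x := (V 0%N)%:E + \sum_(k <oo) g k x.
have fG x : (f x)%:E <= G x.
  have S0 : 0 <= \sum_(k <oo) g k x by apply: nneseries_ge0.
  have [fV0|[k Ek fVk]] := fV x; first by apply: le_trans (leeDl _ S0); rewrite lee_fin.
  apply: (@le_trans _ _ (\sum_(k <oo) g k x)); last by rewrite leeDr// lee_fin.
  apply: le_trans (nneseries_lim_ge k.+1 _); last by move=> *; exact: g0.
  rewrite big_nat_recr//= {2}/g indicE mem_set// mule1.
  apply: (@le_trans _ _ (V k.+1)%:E); first by rewrite lee_fin.
  by apply: leeDr; apply: sume_ge0 => i _; exact: g0.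
apply: le_lt_trans (ge0_le_integralT _ fG) _; first by move=> x; rewrite lee_fin.
rewrite ge0_integralD//; last 3 first.
- by move=> x _; rewrite lee_fin.
- by move=> x _; apply: nneseries_ge0.
- by apply: ge0_emeasurable_sum.
have -> : \int[mu]_x (V 0%N)%:E = (V 0%N)%:E.
  rewrite integral_cst// -[RHS]mule1; congr (_ * _); exact: probability_setT.
rewrite lte_add_pinfty ?ltry// integral_nneseries//.
apply: (@le_lt_trans _ _ M%:E); last exact: ltry.
apply: lime_le; first by apply: is_cvg_nneseries => n _ _; exact: integral_ge0.
apply: nearW => n.
apply: (@le_trans _ _ (\sum_(k < n) V k.+1 * b k)%:E); last first.
  by rewrite lee_fin.
rewrite big_mkord -sumEFin; apply: lee_sum => k _.
rewrite ge0_integralZl_EFin//.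
  rewrite integral_indic// setIT EFinM; apply: lee_wpmul2l.
    by rewrite lee_fin.
  exact: mub.
by apply/measurable_EFinP; exact: measurable_indic.
Qed.

End IntegralBound.

(** * Distances along orbits, layer by layer *)

Section OrbitDistance.
Variables (R : realType) (a r : nat -> nat).
Hypothesis a_gt0 : forall k, (0 < a k)%N.
Variables (H K : groupType) (F : nat -> {fset H}) (G : nat -> {fset K}).
Variables (t : nat -> nat -> H) (s : nat -> nat -> K).
Hypotheses (tP : tile_enum a F t) (sP : tile_enum a G s).
Local Notation T := (measurableTypeR R).
Local Notation actH := (@tile_act R a H t : H -> T -> T).
Local Notation actK := (@tile_act R a K s : K -> T -> T).

Lemma orbit_dist_le d (Y : measurableType d) (L : groupType)
    (S : set L) (act : L -> Y -> Y) x g :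
  (orbit_dist S act x (act g x) <= word_length S g)%N.
Proof.
have D0 :
    [set word_length S l | l in [set l | act g x = act l x]] (word_length S g).
  by exists g.
by have [_] := min_natP (ex_intro _ _ D0); apply.
Qed.

Variables (S : set K) (C : nat) (l : nat -> nat).
Hypothesis wordS : forall k u v, u \in G k -> v \in G k ->
  (word_length S (u * v^-1)%g <= C * l k)%N.

Lemma orbit_dist_fixed x : orbit_dist S actK x x = 0%N.
Proof.
apply/eqP; rewrite -leqn0 -(word_length1 S).
rewrite -[X in orbit_dist _ _ _ X](tile_act1 a_gt0 sP x).
exact: orbit_dist_le.
Qed.

Lemma orbit_dist_block k x y :
  same_block a k x y -> (orbit_dist S actK x y <= C * l k)%N.
Proof.
move=> /(block_reach sP)[u [v [uG vG xy]]].
have [rx|nrx] := pselect (regular a s x).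
  rewrite -(tile_act_reach a_gt0 sP rx xy); apply: leq_trans (wordS uG vG).
  exact: orbit_dist_le.
(* An irregular [x] is fixed by the whole group, so no element carries it to another [y], and the
   distance takes its default value 0. *)
have [->|yx] := eqVneq y x; first by rewrite orbit_dist_fixed.
rewrite /orbit_dist (_ : [set g | y = actK g x] = set0) ?image_set0 ?min_nat0//.
by apply/seteqP; split => // g /= /eqP; rewrite tile_act_irregular// (negPf yx).
Qed.

(** Take the least level at which [h] moves [x] inside its block: if it is k+1, then [x] escapes at
    level k. *)
Lemma orbit_dist_layers h x : (orbit_dist S actK x (actH h x) <= C * l 0)%N \/
  exists2 k, escape_set a F t k h x &
    (orbit_dist S actK x (actH h x) <= C * l k.+1)%N.
Proof.
have [rx|nrx] := pselect (regular a t x); last first.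
  by left; rewrite tile_act_irregular// orbit_dist_fixed.
have ex : exists k, `[< exists y, reach a t k h x y >].
  by have [k [y xy]] := rx.2 h; exists k; apply/asboolP; exists y.
have [k /asboolP[y xy] mink] := ex_minnP ex.
rewrite (tile_act_reach a_gt0 tP rx xy).
have := orbit_dist_block (reach_block xy).
case: k mink xy => [|k] mink xy; first by left.
right; exists k => //; case: (reach_or_escape a_gt0 tP k h rx.1) => // kxy.
by have := mink k; rewrite ltnn => /(_ (asboolT kxy)).
Qed.

End OrbitDistance.

(** The escape rate 2^k of the integers survives every wreath product, while the sizes gain an
    exponential each time. *)
Lemma iterated_wreath_tiles m n : (1 < m)%N ->
  exists F : nat -> {fset iterated_wreath m n},
    [/\ tile_sequence F, escape_rate F (expn 2),
        length_growth F (tile_length m n) &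
        forall k, #|` F k| = tile_size m n k].
Proof.
move=> m1; elim: n => [|n [F [tF eF lF cF]]].
  have pow2_gt0 k : (0 < 2 ^ k)%N by rewrite expn_gt0.
  exists (fun k => Zinterval (2 ^ k)); split.
  - by apply: tile_sequence_Zinterval => // k; rewrite expnS dvdn_mull.
  - exact: escape_rate_Zinterval.
  - exact: length_growth_Zinterval.
  - by move=> k; rewrite card_Zinterval.
exists (fun k => wreath_tile m (F k)); split.
- exact: tile_sequence_wreath.
- exact: escape_rate_wreath.
- have -> : tile_length m n.+1 = (fun k => #|` F k| * tile_length m n k)%N.
    by apply/funext => k; rewrite cF.
  apply: length_growth_wreath => // [k|k]; first exact: tF.1.
  exact: tile_length_gt0.
- by move=> k; rewrite card_wreath_tile// cF.
Qed.

Lemma geometric_half_sum (R : realType) N : \sum_(k < N) (2 ^+ k)^-1 <= 2 :> R.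
Proof.
suff -> : \sum_(k < N) (2 ^+ k)^-1 = 2 - 2 / 2 ^+ N :> R.
  by rewrite lerBlDr lerDl divr_ge0// exprn_ge0.
elim: N => [|N IH]; first by rewrite big_ord0 expr0 divr1 subrr.
by rewrite big_ord_recr/= IH exprS invfM mulVKf ?pnatr_eq0//; lra.
Qed.

(** * The coupling of two groups with equal tile sizes *)

Section TileCoupling.
Variables (R : realType) (a : nat -> nat) (H K : groupType).
Variables (F : nat -> {fset H}) (G : nat -> {fset K}).
Variables (t : nat -> nat -> H) (s : nat -> nat -> K).
Variables (rF rG : nat -> nat) (eF : nat -> H) (eG : nat -> K).
Hypotheses (a_gt0 : forall k, (0 < a k)%N).
Hypotheses (cF : forall k, #|` F k| = a k) (cG : forall k, #|` G k| = a k).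
Hypotheses (tP : tile_enum a F t) (sP : tile_enum a G s).
Hypotheses (FP : escape_rate F rF) (GP : escape_rate G rG).
Hypotheses (rF_gt : forall k, (k < rF k)%N) (rG_gt : forall k, (k < rG k)%N).
Hypotheses (eF_surj : forall h, exists n, eF n = h).
Hypotheses (eG_surj : forall h, exists n, eG n = h).
Local Notation T := (measurableTypeR R).
Local Notation mu := (@unit_measure R).
Local Notation actH := (@tile_act R a H t : H -> T -> T).
Local Notation actK := (@tile_act R a K s : K -> T -> T).

Lemma oe_coupling_tile_act : oe_coupling mu actH actK.
Proof.
split.
- exact: standard_borel_measurableTypeR.
- exact: (pmp_free_tile_act _ cF a_gt0 tP FP rF_gt eF_surj).
- exact: (pmp_free_tile_act _ cG a_gt0 sP GP rG_gt eG_surj).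
- apply: negligibleS (negligibleU (regular_ae _ cF a_gt0 tP FP rF_gt eF_surj)
    (regular_ae _ cG a_gt0 sP GP rG_gt eG_surj)) => x nx.
  apply: contrapT => /not_orP[/contrapT rx /contrapT rx']; apply: nx.
  have := esym (orbit_tile_act a_gt0 sP rx').
  exact: etrans (orbit_tile_act a_gt0 tP rx).
Qed.

(** Serves both halves of integrability, with the groups exchanged: layer k has values at most
    [V k.+1] and lies in an escape set of measure O(1 / [rF k]). *)
Lemma integral_orbit_dist_lty (S : set K) (l : nat -> nat) (C : nat) (h : H)
    (f : R -> R) (V : nat -> R) (M : R) :
  (forall k u v, u \in G k -> v \in G k ->
    (word_length S (u * v^-1)%g <= C * l k)%N) ->
  (forall x, 0 <= x -> 0 <= f x) -> (forall k, 0 <= V k) ->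
  (forall d k, (d <= C * l k)%N -> f d%:R <= V k) ->
  (forall N, \sum_(k < N) V k.+1 / (rF k)%:R <= M) ->
  (\int[mu]_x (f (orbit_dist S actK x (actH h x))%:R)%:E < +oo)%E.
Proof.
move=> wordS f0 V0 fV VM.
have [D HD] := measure_escape_set_le R cF a_gt0 tP FP rF_gt h.
apply: (@integral_layers_lty _ T R mu _ V (fun k => D%:R / (rF k)%:R)
  (fun k => escape_set a F t k h) (D%:R * M)) => //.
- by move=> x; exact: f0.
- by move=> k; exact: measurable_escape_set.
- move=> N; under eq_bigr do rewrite mulrCA.
  by rewrite -mulr_sumr ler_wpM2l.
- move=> x.
  have [dx|[k kx dx]] := orbit_dist_layers a_gt0 tP sP wordS h x.
    by left; exact: fV.
  by right; exists k => //; exact: fV.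
Qed.

End TileCoupling.

Theorem corollary7p6 (R : realType) (m n : nat) (hm : (2 <= m)%N)
    (hn : (1 <= n)%N) :
  exists (d : measure_display) (X : measurableType d) (mu : probability X R)
      (a : Zgroup -> X -> X) (b : iterated_wreath m n -> X -> X),
    oe_coupling mu a b /\
    forall (SZ : set Zgroup) (SG : set (iterated_wreath m n)),
      finite_symmetric_generating SZ -> finite_symmetric_generating SG ->
    forall (eps : R) (psi : R -> R), 0 < eps -> represents_phi n eps psi ->
      Linfty_psi_integrable mu SZ SG a b psi.
Proof.
have [G [tG rG lG cG]] := iterated_wreath_tiles n hm.
pose a := tile_size m n; have a_gt0 : forall k, (0 < a k)%N := tile_size_gt0 hm n.
(* The intervals have the sizes of the tiles of the wreath product, so both groups act with the same
   blocks. *)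
pose F k := Zinterval (a k); have cF k : #|` F k| = a k by exact: card_Zinterval.
have tF : tile_sequence F.
  by apply: tile_sequence_Zinterval => //; exact: tile_size_dvd.
have [t] := tile_sequence_enum tF; rewrite (funext cF) => tP.
have [s] := tile_sequence_enum tG; rewrite (funext cG) => sP.
have rF : escape_rate F a := escape_rate_Zinterval a.
have lF : length_growth F a := length_growth_Zinterval a_gt0.
have exp2_gt k : (k < 2 ^ k)%N by exact: ltn_expl.
have a_gt k : (k < a k)%N by exact: leq_trans (exp2_gt k) (exp2_le_tile_size hm n k).
(* These generating sets serve to enumerate the groups; the coupling is chosen before [SZ] and
   [SG]. *)
have [SZ0 /finite_symmetric_generating_enum[eF eF_surj]] :=
  generates_words generates_Zgroup.
have [SG0 /finite_symmetric_generating_enum[eG eG_surj]] := iterated_wreath_fg m n.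
exists _, (measurableTypeR R), (@unit_measure R), (tile_act a t), (tile_act a s).
split.
  exact: (oe_coupling_tile_act R a_gt0 cF cG tP sP rF rG a_gt exp2_gt
    eF_surj eG_surj).
move=> SZ SG genZ genG eps psi eps0 psiP; split=> [g p p1|g].
  have [C wordC] := word_length_growth genG lG.
  (* An integer above [p], since [tile_length_pow] concerns integer powers. *)
  pose q := (Num.truncn p).+1.
  have [D HD] := tile_length_pow hm q hn.
  pose l := tile_length m n.
  apply: (@integral_orbit_dist_lty _ _ _ _ _ _ _ _ a a_gt0 cF tP sP rF a_gt SG l C g
    (fun x => x `^ p) (fun k => (C.+1 * l k)%:R ^+ q) (C.+1%:R ^+ q * (D%:R * 2))) => //.
  - by move=> x _; exact: powR_ge0.
  (* [C.+1] keeps the base at least 1, so that raising the exponent from [p] to [q] does not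
     decrease the power. *)
  - move=> d k dk; have Cl : (1 : R) <= (C.+1 * l k)%:R.
      by rewrite ler1n muln_gt0 tile_length_gt0.
    apply: (@le_trans _ _ ((C.+1 * l k)%:R `^ p)).
      apply: ge0_ler_powR; rewrite ?nnegrE ?ler0n//; first by lra.
      by rewrite ler_nat (leq_trans dk)// leq_mul2r leqnSn orbT.
    rewrite -powR_mulrn ?ler0n// ler_powR//.
    exact/ltW/truncnS_gt.
  - move=> N.
    apply: (@le_trans _ _
      (\sum_(k < N) C.+1%:R ^+ q * (D%:R * (2 ^+ k)^-1))).
      apply: ler_sum => k _; rewrite natrM exprMn -mulrA ler_wpM2l ?exprn_ge0//.
      rewrite ler_pdivrMr ?ltr0n// mulrAC ler_pdivlMr ?exprn_gt0//.
      by rewrite -!natrX -!natrM ler_nat HD.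
    by rewrite -!mulr_sumr !ler_wpM2l ?exprn_ge0// geometric_half_sum.
have [C wordC] := word_length_growth genZ lF.
have [psi_le psi_ge0 _] := psiP.
(* Distances within a level-k block are at most [C * a k]; division by the positive number [C.+1]
   brings them below [a k]. *)
exists C.+1%:R; first by rewrite ltr0n.
have [M _ HM] := represents_phi_sum hm eps0 psiP.
apply: (@integral_orbit_dist_lty _ _ _ _ _ _ _ _ _ a_gt0 cG sP tP rG exp2_gt SZ a C g
  (fun x => psi (x / C.+1%:R)) (fun k => psi (a k)%:R) M) => //.
- by move=> x x0; apply: psi_ge0; rewrite divr_ge0.
- by move=> k; exact: psi_ge0.
- move=> d k dk; apply: psi_le; first by rewrite divr_ge0.
  rewrite ler_pdivrMr ?ltr0n// -natrM ler_nat (leq_trans dk)// mulnC.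
  by rewrite leq_mul2l leqnSn orbT.
- by move=> N; under eq_bigr do rewrite natrX; exact: HM.
Qed.
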